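(* Let $\sigma$ be a triangulation of a polygon $P$ with $n\ge3$ vertices, $\Gamma_\sigma$ its frozen Jacobian algebra, regarded as an $R$-algebra via $x\mapsto C$ (see context), and $e_F=\sum_{i\in F}e_i$. Then the $R$-order $e_F\Gamma_\sigma e_F$ is isomorphic, as an $R$-order, to the tiled $R$-order $\Lambda\subset M_n(K(x))$ whose $(i,j)$ entry ranges over $x^{c_{ij}}R$, where $c_{ij}=0$ if $i\le j$ and $(i,j)\ne(1,n)$, $c_{1n}=-1$, $c_{ij}=1$ if $i=j+1$, and $c_{ij}=2$ if $i\ge j+2$; i.e. $$\Lambda=\begin{bmatrix} R&R&\cdots&R&(x^{-1})\\ (x)&R&\cdots&R&R\\ (x^2)&(x)&\cdots&R&R\\ \vdots&&\ddots&&\vdots\\ (x^2)&(x^2)&\cdots&(x)&R\end{bmatrix}.$$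
   Context: Let $K$ be a field and $R=K[x]$. Let $P$ be a regular polygon with $n\ge3$ vertices $P_1,\dots,P_n$ labelled counterclockwise; a triangulation $\sigma$ is a decomposition of $P$ into triangles by a maximal set of pairwise non-crossing diagonals (diagonals are segments between vertices lying in the interior of $P$; crossing means sharing an interior point). The quiver $Q_\sigma$ has as vertices the edges of $\sigma$ (sides of $P$ and diagonals of $\sigma$); for two edges $a,b$ which are sides of a common triangle of $\sigma$ there is an internal arrow $a\to b$ if $a$ precedes $b$ anticlockwise around their common vertex; for each vertex of $P$ incident to at least one diagonal there is an external arrow $a\to b$ between the two sides of $P$ at that vertex, $a$ preceding $b$ anticlockwise around it. Minimal cycles are the cycles without repeated arrows enclosing a region with connected interior containing no arrow: cyclic triangles (three internal arrows in a triangle of $\sigma$) and big cycles (internal arrows plus one external arrow around a vertex of $P$). $W_\sigma=\sum\text{cyclic triangles}-\sum\text{big cycles}$; $F$ = set of vertices corresponding to sides of $P$; $\Gamma_\sigma=KQ_\sigma/J$ where $J$ is generated by the cyclic derivatives $\partial_aW_\sigma$ ($\partial_a(a_1\cdots a_d)=\sum_{a_i=a}a_{i+1}\cdots a_da_1\cdots a_{i-1}$) for arrows $a$ with source or target outside $F$. $e_i$ is the trivial path at vertex $i$. All minimal cycles through a vertex $i$ (as cycles at $i$) coincide in $\Gamma_\sigma$; call their common class $C_i$ and set $C=\sum_iC_i$. The $R$-algebra structure on $\Gamma_\sigma$ is given by $x^k\mapsto C^k$. An $R$-order is an $R$-algebra finitely generated and free as an $R$-module. *)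

(* Defs.v *)
From HB Require Import structures.
From mathcomp Require Import all_boot all_algebra fraction.
From mathcomp Require Import finmap.
From mathcomp Require Import monalg.

Set Implicit Arguments.
Unset Strict Implicit.
Unset Printing Implicit Defensive.

Import GRing.Theory.
Local Open Scope ring_scope.

(* Polygon with n vertices P_1..P_n, here 0-indexed as 'I_n,           *)
(* labelled counterclockwise.  A segment between two vertices is the   *)
(* normalized pair (i, j) with i < j.                                   *)
Section Triangulations.
Variable n : nat.

Definition pedge := ('I_n * 'I_n)%type.

Definition adjacent (i j : 'I_n) : bool :=
  [|| (j : nat) == i.+1, (i : nat) == j.+1,
      ((i : nat) == 0%N) && ((j : nat) == n.-1)
    | ((j : nat) == 0%N) && ((i : nat) == n.-1)].

Definition side (e : pedge) : bool := (e.1 < e.2)%N && adjacent e.1 e.2.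
Definition diag (e : pedge) : bool := (e.1 < e.2)%N && ~~ adjacent e.1 e.2.

(* two diagonals of a convex polygon share an interior point iff their
   endpoints strictly interleave *)
Definition cross (d1 d2 : pedge) : bool :=
  let: (a, b) := d1 in let: (c, d) := d2 in
  ((a < c < b)%N && (b < d)%N) || ((c < a < d)%N && (d < b)%N).

Definition is_triangulation (sigma : {set pedge}) : Prop :=
  [/\ forall d, d \in sigma -> diag d,
      forall d1 d2, d1 \in sigma -> d2 \in sigma -> ~~ cross d1 d2
    & forall d, diag d -> d \notin sigma -> exists2 d', d' \in sigma & cross d d'].

Variable sigma : {set pedge}.

(* edges of sigma: sides of P and diagonals of sigma; these are the
   vertices of the quiver Q_sigma *)
Definition edgeset : {set pedge} := [set e | side e || (e \in sigma)].

Definition mkE (i j : 'I_n) : pedge := if (i < j)%N then (i, j) else (j, i).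

Definition is_edge (i j : 'I_n) : bool := (i != j) && (mkE i j \in edgeset).

Definition triangle (p q r : 'I_n) : bool :=
  [&& (p < q)%N, (q < r)%N, is_edge p q, is_edge q r & is_edge p r].

(* internal arrows: in the triangle p < q < r, going anticlockwise around
   P_p one meets (p,q) then (p,r); around P_q, (q,r) then (p,q); around
   P_r, (p,r) then (q,r). *)
Definition internal_arrow (a b : pedge) : bool :=
  [exists p : 'I_n, exists q : 'I_n, exists r : 'I_n,
     triangle p q r &&
     [|| (a, b) == ((p, q), (p, r)),
         (a, b) == ((p, r), (q, r))
       | (a, b) == ((q, r), (p, q))]].

Definition has_diag (v : 'I_n) : bool :=
  [exists d in sigma, (d.1 == v) || (d.2 == v)].

(* external arrows: around P_v, anticlockwise, the side (v-1,v) precedes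
   the side (v,v+1) (passing through the exterior of P) *)
Definition external_arrow (a b : pedge) : bool :=
  [exists v : 'I_n, [&& has_diag v, a == mkE (ord_pred v) v & b == mkE v (ordS v)]].

Definition arrow (a b : pedge) : bool :=
  [&& a \in edgeset, b \in edgeset & internal_arrow a b || external_arrow a b].

Definition frozen (e : pedge) : bool := side e.

(* paths of Q_sigma, as nonempty sequences of vertices (Q_sigma has no
   multiple arrows); [:: v] is the trivial path e_v *)
Definition is_qpath (s : seq pedge) : bool :=
  if s is v :: s' then (v \in edgeset) && path arrow v s' else false.

Definition qpath := {s : seq pedge | is_qpath s}.

Variable K : fieldType.

Definition KQ := {malg K[qpath]}.

Definition pathel (s : seq pedge) : KQ :=
  if insub s is Some p then << (p : qpath) >> else 0.

Definition olast (s : seq pedge) := ohead (rev s).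

Definition pmul_path (p q : qpath) : KQ :=
  if olast (val p) == ohead (val q) then pathel (val p ++ behead (val q))
  else 0.

Definition kqmul (u v : KQ) : KQ :=
  \sum_(p <- msupp u) \sum_(q <- msupp v) (u@_p * v@_q) *: pmul_path p q.

Definition idem (v : pedge) : KQ := pathel [:: v].

Definition eF : KQ := \sum_(e : pedge | frozen e) idem e.

(* cycles are given as sequences c = [:: c_0; ...; c_{d-1}] of vertices,
   with arrows c_i -> c_{i+1 mod d}.  Cyclic derivative w.r.t. the arrow a:
   sum over positions i with (c_i, c_{i+1}) = a of the path
   c_{i+1} ... c_{d-1} c_0 ... c_i. *)
Definition cdiff (c : seq pedge) (a : pedge * pedge) : KQ :=
  \sum_(i < size c)
     (if ohead (drop i (zip c (rot 1 c))) == Some a then pathel (rot i.+1 c)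
      else 0).

Definition tri_cycle (p q r : 'I_n) : seq pedge := [:: (p, q); (p, r); (q, r)].

(* the neighbours of P_v in sigma, in anticlockwise order starting after v *)
Definition around (v : 'I_n) : seq 'I_n :=
  [seq w <- sort (fun w1 w2 : 'I_n => ((w1 + n - v) %% n <= (w2 + n - v) %% n)%N)
                 (enum 'I_n) | is_edge v w].

Definition big_cycle (v : 'I_n) : seq pedge := [seq mkE v w | w <- around v].

Definition dW (a : pedge * pedge) : KQ :=
  \sum_(t : 'I_n * 'I_n * 'I_n | triangle t.1.1 t.1.2 t.2)
      cdiff (tri_cycle t.1.1 t.1.2 t.2) a
  - \sum_(v : 'I_n | has_diag v) cdiff (big_cycle v) a.

Definition rel_arrow (a : pedge * pedge) : bool :=
  arrow a.1 a.2 && ~~ (frozen a.1 && frozen a.2).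

Definition inJ (u : KQ) : Prop :=
  exists s : seq (KQ * (pedge * pedge) * KQ),
    all (fun x => rel_arrow x.1.2) s /\
    u = \sum_(x <- s) kqmul (kqmul x.1.1 (dW x.1.2)) x.2.

Definition inFF (u : KQ) : Prop := kqmul (kqmul eF u) eF = u.

Definition min_cycle (c : seq pedge) : Prop :=
  (exists p q r, triangle p q r /\ c = tri_cycle p q r) \/
  (exists v, has_diag v /\ c = big_cycle v).

Definition min_cycle_at (i : pedge) (c : seq pedge) : Prop :=
  exists cyc k, [/\ min_cycle cyc, (k < size cyc)%N,
                    ohead (rot k cyc) = Some i & c = rcons (rot k cyc) i].

End Triangulations.

(* (0-indexed: paper's (1,n) is (0, n-1)).                              *)
Definition cexp (n : nat) (i j : 'I_n) : int :=
  if (i <= j)%N then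
    (if ((i : nat) == 0%N) && ((j : nat) == n.-1) then (-1)%R else 0%R)
  else if (i : nat) == j.+1 then 1%R else 2%R.

Definition inLambda (K : fieldType) (n : nat)
    (M : 'M[{fraction {poly K}}]_n) : Prop :=
  forall i j : 'I_n, exists p : {poly K},
    M i j = (tofrac p) * (tofrac ('X : {poly K})) ^ (cexp i j).

(* Main.v *)
Require Import Defs.
From HB Require Import structures.
From mathcomp Require Import all_boot all_algebra fraction.
From mathcomp Require Import finmap monalg.
From mathcomp Require Import zify.
Import GRing.Theory.

(* Edges of the triangulation are lifted to the universal cover of the circle:
   a lift is a pair [a < b < a + n] of naturals, and the arrows of the quiver lift
   to moves increasing one endpoint inside a triangle, or both endpoints past a
   vertex.  Between two lifts, a path exists iff the target dominates the source
   componentwise (no two edges cross), and any two such paths are equal modulo J: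
   if they start with different arrows, the relation of some arrow closes the
   square formed by these, since otherwise the target would cross the source.
   Counting the turns around the polygon gives each path a weight; minimal cycles
   have weight 1 and the two terms of each relation have equal weight.  So paths
   between two sides are classified modulo J by their weight, and the possible
   weights between sides i and j are all the integers above a bound, which is
   c_ij up to the shift [side_level i - side_level j]. *)

Set Implicit Arguments.
Unset Strict Implicit.
Unset Printing Implicit Defensive.

(** Lifting unwinds the cycles of the quiver: a step strictly increases the sum of the two
    endpoints, so paths can be compared by induction on the height between their ends, although in
    the quiver itself a path may return to its start. The lifts of an edge form one orbit of [flip],
    two flips making a full turn. Numbering the orbit turns the weight of a path into a difference
    of two numbers, hence additive. The delicate point is uniqueness, because arrows between two
    sides carry no relation: at most two steps leave a lift, one rotation about each endpoint, and
    the common target of two such paths must decide which relation is applied and guarantee that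
    this relation exists. The kernel is then found without a basis of the Jacobian algebra:
    recording weights is a linear map that kills J, and modulo J the corner is spanned by one chosen
    path for each pair of sides and each weight. The shift by [side_level] is a conjugation by a
    diagonal matrix of powers of x. It is forced by the last side alone, whose sorted pair
    [(0, n - 1)] and whose natural lift [(n - 1, n)] differ by a flip. *)

Local Open Scope nat_scope.

(* The pair [(a, b)] with [a < b < a + n] represents the edge joining the
   vertices [a] and [b] modulo [n]; so does its [flip] [(b, a + n)]. *)
Definition lift_edge := (nat * nat)%type.
Definition vtx m (k : nat) : 'I_m.+3 := inZp k.
Definition proj m (X : lift_edge) : pedge m.+3 := mkE (vtx m X.1) (vtx m X.2).

(** * Edges, noncrossing and triangles in the universal cover *)

Section LiftedEdges.
Variables (m : nat) (sigma : {set pedge m.+3}).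
Local Notation n := m.+3.
Local Notation vtx := (vtx m).
Local Notation proj := (proj m).

Definition edge a b := is_edge sigma (vtx a) (vtx b).
Definition flip (X : lift_edge) : lift_edge := (X.2, X.1 + n).
Definition lifted (X : lift_edge) := [&& X.1 < X.2, X.2 < X.1 + n & edge X.1 X.2].
Definition tri a b c := [&& a < b, b < c, c < a + n, edge a b, edge b c & edge a c].

Lemma vtxD a : vtx (a + n) = vtx a.
Proof. by apply/val_inj; rewrite /= modnDr. Qed.

Lemma vtx_small a : a < n -> vtx a = a :> nat.
Proof. by move=> an; rewrite /= modn_small. Qed.

Lemma vtxK (i : 'I_n) : vtx i = i.
Proof. exact: valZpK. Qed.

Lemma mkEC (i j : 'I_n) : mkE i j = mkE j i.
Proof. by rewrite /mkE; case: ltngtP => // /val_inj ->. Qed.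

Lemma is_edgeC (i j : 'I_n) : is_edge sigma i j = is_edge sigma j i.
Proof. by rewrite /is_edge eq_sym mkEC. Qed.

Lemma edgeC a b : edge a b = edge b a.
Proof. exact: is_edgeC. Qed.

Lemma edgeDl a b : edge (a + n) b = edge a b.
Proof. by rewrite /edge vtxD. Qed.

Lemma edgeDr a b : edge a (b + n) = edge a b.
Proof. by rewrite /edge vtxD. Qed.

Lemma proj_flip X : proj (flip X) = proj X.
Proof. by rewrite /proj /= mkEC vtxD. Qed.

Lemma lifted_flip X : lifted (flip X) = lifted X.
Proof.
case: X => a b; rewrite /lifted /= edgeDr (edgeC b) ltn_add2r.
by case: (edge a b); rewrite ?andbF // andbT andbT andbC.
Qed.

Lemma edge_small i j : i < j < n -> edge i j = ((vtx i, vtx j) \in edgeset sigma).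
Proof.
case/andP=> ij jn; have jn' : i < n by lia.
rewrite /edge /is_edge /mkE !vtx_small // ij -val_eqE /= !modn_small //.
by rewrite neq_ltn ij.
Qed.

Lemma side_edgeset e : side e -> e \in edgeset sigma.
Proof. by move=> s; rewrite inE s. Qed.

Lemma edge_side a : edge a a.+1.
Proof.
elim/ltn_ind: a => a IH; case: (ltnP a n) => an; last first.
  by rewrite -(subnK an) -addSn edgeDl edgeDr IH //; lia.
have [an1|an1] : a.+1 < n \/ a = m.+2 by lia.
  rewrite edge_small; last lia.
  by apply: side_edgeset; rewrite /side /adjacent /= !modn_small //; lia.
have -> : a.+1 = 0 + n by lia.
rewrite edgeDr edgeC edge_small; last lia.
by apply: side_edgeset; rewrite /side /adjacent /= !modn_small //; lia.
Qed.

Lemma edge_side' a : edge a (a + m.+2).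
Proof. by rewrite edgeC -edgeDr (addnS a m.+2) edge_side. Qed.

Hypothesis triS : is_triangulation sigma.

Lemma edgeset_noncross e1 e2 :
  e1 \in edgeset sigma -> e2 \in edgeset sigma -> ~~ cross e1 e2.
Proof.
have [_ nc _] := triS.
case: e1 e2 => [a b] [c d]; rewrite !inE.
have := ltn_ord a; have := ltn_ord b; have := ltn_ord c; have := ltn_ord d.
move=> ? ? ? ?.
case/orP=> [s1|h1]; last case/orP=> [s2|h2]; last exact: nc.
  by move=> _; move: s1; rewrite /side /adjacent /cross /=; lia.
by move: s2; rewrite /side /adjacent /cross /=; lia.
Qed.

Lemma noncross_small i j k l : i < j -> j < k -> k < l -> l < n ->
  edge i k -> edge j l -> False.
Proof.
move=> ij jk kl ln; rewrite !edge_small; try lia.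
move=> e1 e2; have := edgeset_noncross e1 e2.
by rewrite /cross !vtx_small; lia.
Qed.

(** Removing a period from the coordinates beyond [n] permutes the four points cyclically and keeps
    them interleaved, so every case falls back on vertices below [n]. *)
Lemma noncross a b c d : a < c -> c < b -> b < d -> d < a + n ->
  edge a b -> edge c d -> False.
Proof.
elim/ltn_ind: a b c d => a IH b c d ac cb bd dan.
case: (ltnP a n) => an; last first.
  have [bn cn dn] : [/\ n <= b, n <= c & n <= d] by split; lia.
  rewrite -(subnK an) -(subnK bn) -(subnK cn) -(subnK dn) !edgeDl !edgeDr.
  by apply: IH; lia.
case: (ltnP d n) => dn; first exact: noncross_small.
rewrite -(subnK dn) edgeDr; case: (ltnP b n) => bn.
  by rewrite (edgeC c) => e1 e2; apply: (@noncross_small (d - n) a c b) => //; lia.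
rewrite -(subnK bn) edgeDr (edgeC a); case: (ltnP c n) => cn.
  by rewrite (edgeC c) => e1 e2; apply: (@noncross_small (b - n) (d - n) a c) => //; lia.
rewrite -(subnK cn) edgeDl => e1 e2.
by apply: (@noncross_small (c - n) (b - n) (d - n) a) => //; lia.
Qed.

Lemma maximal_small i j : i < j -> j < n -> ~~ edge i j ->
  exists x y, [/\ i < x, x < j, j < y, y < i + n & edge x y].
Proof.
have [dg _ mx] := triS.
move=> ij jn; rewrite edge_small ?ij // inE negb_or => /andP[ns nsig].
have iln : i < n by lia.
have dij : diag (vtx i, vtx j).
  by move: ns; rewrite /side /diag /= !modn_small // ij.
have [[x y] d1] := mx _ dij nsig.
have := dg _ d1; rewrite /diag => /andP[/= xy _].
have e1 : edge x y.
  by rewrite edge_small ?xy ?ltn_ord // !vtxK inE d1 orbT.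
have := ltn_ord y; rewrite /cross !modn_small // => yn /orP[] h.
  by exists x, y; split => //; lia.
by exists y, (x + n); rewrite edgeDr edgeC; split => //; lia.
Qed.

Lemma maximal a b : a < b -> b < a + n -> ~~ edge a b ->
  exists x y, [/\ a < x, x < b, b < y, y < a + n & edge x y].
Proof.
elim/ltn_ind: a b => a IH b ab ban.
case: (ltnP a n) => an; last first.
  have bn : n <= b by lia.
  rewrite -{1}(subnK an) -{1}(subnK bn) edgeDl edgeDr => /IH[]; try lia.
  move=> x [y [? ? ? ? e]]; exists (x + n), (y + n).
  by rewrite edgeDl edgeDr; split => //; lia.
case: (ltnP b n) => bn; first exact: maximal_small.
rewrite -{1}(subnK bn) edgeDr edgeC => /maximal_small[]; try lia.
move=> x [y [? ? ? ? e]]; case: (ltnP y n) => yn.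
  by exists y, (x + n); rewrite edgeDr edgeC; split => //; lia.
by exists y, (x + n); rewrite edgeDr edgeC; split => //; lia.
Qed.

(* The apex of the triangle on [a, b] is the last neighbour of [a] before [b]. *)
Lemma apex a b : a.+1 < b -> b < a + n -> edge a b ->
  exists c, tri a c b.
Proof.
move=> ab ban eab.
pose P k := [&& a < k, k < b & edge a k].
have exP : exists k, P k by exists a.+1; rewrite /P edge_side; lia.
have ubP k : P k -> k <= b by rewrite /P; lia.
case: (ex_maxnP exP ubP) => c /and3P[ac cb eac] maxc.
exists c; rewrite /tri ac cb ban eac eab /= andbT.
apply/negPn/negP => necb; have [||x [y []]] := maximal _ _ necb; try lia.
move=> cx xb byy yc exy.
(* The edge [(x, y)] would cross [(a, b)] if [y < a + n], and cross [(a, c)] one turn earlier if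
   [y > a + n]; for [y = a + n] it makes [x] a later neighbour of [a] than [c]. *)
case: (ltngtP y (a + n)) => yan.
- by apply: (@noncross a b x y) => //; lia.
- rewrite -(subnK (_ : n <= y)) in exy; last lia.
  rewrite edgeDr edgeC in exy.
  case: (ltngtP a (y - n)) => h; try lia.
  by apply: (@noncross a c (y - n) x) => //; lia.
- move: exy; rewrite yan edgeDr edgeC => exy.
  by have := maxc x; rewrite /P exy; lia.
Qed.

(** The flip [(b, a + n)] shows the other side of the edge, where [apex] applies. *)
Lemma outer_apex a b : a < b -> b.+1 < a + n -> edge a b -> exists c, tri a b c.
Proof.
move=> ab ban eab; have [|||c] := @apex b (a + n); try lia.
  by rewrite edgeDr edgeC.
rewrite /tri !edgeDr (edgeC b a) (edgeC c a) => /and5P[? ? ? ? /andP[? ?]].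
by exists c; rewrite /tri eab; lia.
Qed.

Lemma tri_uniq_out a b c d : tri a b c -> tri a b d -> c = d.
Proof.
case/and5P=> ? ? ? ? /andP[? ?] /and5P[? ? ? ? /andP[? ?]].
case: (ltngtP c d) => // h; exfalso.
  by apply: (@noncross a c b d); lia.
by apply: (@noncross a d b c); lia.
Qed.

Lemma tri_rot a b c : tri a b c -> tri b c (a + n).
Proof.
by rewrite /tri !edgeDr (edgeC a b) (edgeC a c); lia.
Qed.

Lemma tri_shift a b c : tri (a + n) (b + n) (c + n) = tri a b c.
Proof. by rewrite /tri !edgeDl !edgeDr; lia. Qed.

End LiftedEdges.

(** * Steps between lifts and the numbering of lifts *)

Section Steps.
Variables (m : nat) (sigma : {set pedge m.+3}).
Local Notation n := m.+3.
Local Notation vtx := (vtx m).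
Local Notation proj := (proj m).
Local Notation edge := (edge sigma).
Local Notation tri := (tri sigma).
Local Notation flip := (flip m).
Local Notation lifted := (lifted sigma).

Definition hasdiag a := has_diag sigma (vtx a).

(* Anticlockwise rotation about the first endpoint [X.1]; the second case is
   the external arrow from the side before [X.1] to the side after it. *)
Definition rot1 (X Y : lift_edge) :=
  (X.1 == Y.1) && tri X.1 X.2 Y.2 ||
  [&& X.2 == X.1 + m.+2, Y == (X.1.+1, X.1 + n) & hasdiag X.1].

(** Rotating about the second endpoint is rotating the flip about its first endpoint, so one
    relation serves both. *)
Definition step X Y := rot1 X Y || rot1 (flip X) (flip Y).

(** A valid lift is an iterated flip of the sorted pair of its edge; this is the number of flips. *)
Definition floors (X : lift_edge) := X.1 %/ n + X.2 %/ n.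

Definition lift_at (e : pedge n) k : lift_edge := iter k flip (e.1 : nat, e.2 : nat).

(** The number of flips gained along an arrow. Lifts grow along a step, so the sum of the sorted
    coordinates can only drop when a moving endpoint reaches or passes the vertex 0. *)
Definition descent (e f : pedge n) : nat := f.1 + f.2 < e.1 + e.2.

Definition le_edge (X Y : lift_edge) := (X.1 <= Y.1) && (X.2 <= Y.2).

Lemma hasdiagD a : hasdiag (a + n) = hasdiag a.
Proof. by rewrite /hasdiag vtxD. Qed.

Lemma rot1_shift X Y :
  rot1 (flip (flip X)) (flip (flip Y)) = rot1 X Y.
Proof.
case: X Y => [a b] [c d]; rewrite /rot1 /= tri_shift hasdiagD !xpair_eqE.
by rewrite eqn_add2r -!addSn !eqn_add2r -addnA (addnC n) addnA eqn_add2r.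
Qed.

Lemma step_flip X Y : step (flip X) (flip Y) = step X Y.
Proof. by rewrite /step rot1_shift orbC. Qed.

Lemma rot1_lifted X Y : rot1 X Y -> lifted X /\ lifted Y.
Proof.
case: X Y => [a b] [c d]; rewrite /rot1 /lifted /=.
case/orP=> [/andP[/eqP <-]|/and3P[/eqP-> /eqP[-> ->] _]].
  by case/and5P=> ? ? ? -> /andP[_ ->]; lia.
by rewrite edge_side' edgeDr edgeC edge_side; lia.
Qed.

Lemma step_lifted X Y : step X Y -> lifted X /\ lifted Y.
Proof.
by case/orP=> /rot1_lifted; rewrite ?lifted_flip.
Qed.

Lemma rot1_le X Y : rot1 X Y -> le_edge X Y /\ X.1 + X.2 < Y.1 + Y.2.
Proof.
case: X Y => [a b] [c d]; rewrite /rot1 /le_edge /=.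
case/orP=> [/andP[/eqP <-]|/and3P[/eqP-> /eqP[-> ->] _]]; last by lia.
by case/and5P; lia.
Qed.

Lemma step_le X Y : step X Y -> le_edge X Y /\ X.1 + X.2 < Y.1 + Y.2.
Proof.
by case/orP=> /rot1_le; rewrite /le_edge /=; lia.
Qed.

Lemma proj_lift_at (e : pedge n) k : e.1 < e.2 -> proj (lift_at e k) = e.
Proof.
move=> e12; elim: k => [|k IH] /=; last by rewrite proj_flip.
by case: e e12 => i j /= ij; rewrite /proj /= !vtxK /mkE ij.
Qed.

Lemma floors_flip X : floors (flip X) = (floors X).+1.
Proof. by rewrite /floors /= divnDr ?dvdnn // divnn /=; lia. Qed.

Lemma floors_lift_at (e : pedge n) k : floors (lift_at e k) = k.
Proof.
elim: k => [|k IH] /=; last by rewrite floors_flip IH.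
by rewrite /floors !divn_small ?ltn_ord.
Qed.

Lemma proj_small a b : a < b -> b < n -> proj (a, b) = (vtx a, vtx b).
Proof.
move=> ab bn; rewrite /proj /mkE /= !modn_small ?ab //; lia.
Qed.

(** Undoing a flip lowers the sum of the coordinates by [n], so facts stable under flips need
    checking only in the window below [n]. *)
Lemma lift_edge_ind (P : lift_edge -> Prop) :
  (forall X, X.2 < n -> P X) -> (forall X, P X -> P (flip X)) ->
  forall X, P X.
Proof.
move=> P0 PS X; have [k] := ubnP (X.1 + X.2); elim: k X => // k IH X hk.
case: (ltnP X.2 n) => h; first exact: P0.
have -> : X = flip (X.2 - n, X.1).
  by case: X h {hk} => a b /= h; rewrite /flip /= subnK.
by apply: PS; apply: IH => /=; lia.
Qed.

Lemma lift_atK X : X.1 < X.2 -> X.2 < X.1 + n -> lift_at (proj X) (floors X) = X.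
Proof.
elim/lift_edge_ind: X => X; last first.
  by move=> IH /= h1 h2; rewrite proj_flip floors_flip /= IH //; lia.
case: X => a b /= bn ab _; have an : a < n by lia.
by rewrite proj_small // /floors /= !divn_small //= !modn_small.
Qed.

Hypothesis triS : is_triangulation sigma.

Lemma edgeset_lt e : e \in edgeset sigma -> e.1 < e.2.
Proof.
have [dg _ _] := triS.
by rewrite inE => /orP[|/dg] /andP[].
Qed.

Lemma lifted_lift_at (e : pedge n) k : e \in edgeset sigma -> lifted (lift_at e k).
Proof.
move=> e_in; have e12 := edgeset_lt e_in.
elim: k => [|k IH] /=; last by rewrite lifted_flip.
have := ltn_ord e.2.
rewrite /lifted /= edge_small ?e12 //= !vtxK -surjective_pairing e_in; lia.
Qed.

Lemma lifted_proj X : lifted X -> proj X \in edgeset sigma.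
Proof. by case/and3P=> _ _ /andP[_]. Qed.

Lemma lift_at_proj X : lifted X -> lift_at (proj X) (floors X) = X.
Proof. by case/and3P=> *; apply: lift_atK. Qed.

Lemma side_proj_lt X : X.1 < X.2 -> X.2 < X.1 + n ->
  side (proj X) = (X.2 == X.1.+1) || (X.2 == X.1 + m.+2).
Proof.
elim/lift_edge_ind: X => X; last first.
  by move=> IH /= h1 h2; rewrite proj_flip IH; lia.
case: X => a b /= bn ab _; have an : a < n by lia.
by rewrite proj_small // /side /adjacent /= !modn_small //; lia.
Qed.

Lemma side_proj X : lifted X ->
  side (proj X) = (X.2 == X.1.+1) || (X.2 == X.1 + m.+2).
Proof. by case/and3P=> *; apply: side_proj_lt. Qed.

(** In the cover the two sides at [a] end at [a.+1] and [a + n - 1], and each diagonal at [a] has a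
    lift that starts at [a] and ends strictly between these. *)
Lemma hasdiagP a :
  reflect (exists w, [/\ a.+1 < w, w.+1 < a + n & edge a w]) (hasdiag a).
Proof.
have [dg _ _] := triS; apply: (iffP existsP) => [[d /andP[ds da]]|[w [aw wa e]]].
  have d_in : d \in edgeset sigma by rewrite inE ds orbT.
  have nsd : ~~ side d by have := dg _ ds; rewrite /diag /side => /andP[-> ->].
  have Hcase X : proj X = d -> X.1 = a -> lifted X ->
     exists w : nat, [/\ a.+1 < w, w.+1 < a + n & edge a w].
    move=> dE aE lX; move: nsd; rewrite -dE side_proj // negb_or => nX.
    by case/and3P: lX => *; exists X.2; rewrite -aE; split => //; lia.
  have e12 := edgeset_lt d_in.
  have aE : a = a %% n + a %/ n * n by rewrite addnC -divn_eq.
  (* Two flips translate by [n]; one more flip puts the second endpoint of [d] first, as needed when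
     [a] lies over [d.2]. *)
  have liftE k : lift_at d k.*2 = (d.1 + k * n, d.2 + k * n).
    elim: k => [|k IH]; first by rewrite /lift_at /= !addn0.
    by rewrite doubleS /lift_at !iterS -/(lift_at _ _) IH /flip /=; congr (_, _); lia.
  case/orP: da => /eqP dv; have := congr1 (@nat_of_ord _) dv; rewrite /= => {}dv.
  - apply: (@Hcase (lift_at d (a %/ n).*2)).
    + by rewrite proj_lift_at.
    + by rewrite liftE /= dv -aE.
    + exact: lifted_lift_at.
  - apply: (@Hcase (lift_at d (a %/ n).*2.+1)).
    + by rewrite proj_lift_at.
    + by rewrite /lift_at iterS -/(lift_at _ _) liftE /= dv -aE.
    + exact: lifted_lift_at.
have lX : lifted (a, w) by rewrite /lifted e /=; lia.
exists (proj (a, w)); apply/andP; split.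
  have := lifted_proj lX; rewrite inE side_proj //= => /orP[]; lia.
by rewrite /proj /mkE /=; case: ifP; rewrite /= eqxx ?orbT.
Qed.

End Steps.

(** * Correspondence between steps and arrows of the quiver *)

Section Arrows.
Variables (m : nat) (sigma : {set pedge m.+3}).
Local Notation n := m.+3.
Local Notation vtx := (vtx m).
Local Notation proj := (proj m).
Local Notation edge := (edge sigma).
Local Notation tri := (tri sigma).
Local Notation flip := (flip m).
Local Notation hasdiag := (hasdiag sigma).
Local Notation rot1 := (rot1 sigma).
Local Notation step := (step sigma).
Local Notation floors := (floors m).

Lemma triangleE p q r : p < q -> q < r -> r < n ->
  triangle sigma (vtx p) (vtx q) (vtx r) = tri p q r.
Proof.
by move=> pq qr rn; rewrite /triangle /tri /edge /= !modn_small; lia.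
Qed.

Lemma ordS_vtx k : ordS (vtx k) = vtx k.+1.
Proof. by apply/val_inj; rewrite /= -addn1 modnDml addn1. Qed.

Lemma ord_pred_vtx k : ord_pred (vtx k.+1) = vtx k.
Proof. by rewrite -ordS_vtx ordSK. Qed.

Lemma external_arrow_proj a : hasdiag a.+1 ->
  external_arrow sigma (proj (a, a.+1)) (proj (a.+1, a.+2)).
Proof.
move=> hd; apply/existsP; exists (vtx a.+1).
by rewrite [has_diag _ _]hd ord_pred_vtx ordS_vtx /proj /= !eqxx.
Qed.

(** In this window the source is the sorted pair at level 0. The cases tell which of the three
    arrows of a triangle, or which external arrow, is the projection; the level rises when a
    coordinate reaches [n]. *)
Lemma step_small X Y : X.2 < n -> step X Y ->
  (internal_arrow sigma (proj X) (proj Y) || external_arrow sigma (proj X) (proj Y))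
  && (floors Y == floors X + descent (proj X) (proj Y)).
Proof.
case: X => a b /= bn /orP[|]; case: Y => c d; rewrite /rot1 /=.
- case/orP=> [/andP[/eqP <-]|/and3P[/eqP bE]].
  + move=> T; have /and5P[ab bd da eab /andP[ebd ead]] := T.
    have an : a < n by lia.
    case: (ltnP d n) => dn.
    * rewrite !proj_small; try lia.
      rewrite /floors /descent /= !divn_small // !modn_small //; apply/andP; split; last by lia.
      apply/orP; left; apply/existsP; exists (vtx a); apply/existsP; exists (vtx b).
      by apply/existsP; exists (vtx d); rewrite triangleE // T eqxx.
    * have [d' dE] : exists d', d = d' + n by exists (d - n); lia.
      rewrite -[proj (a, d)]proj_flip.
      have -> : proj (flip (a, d)) = (vtx d', vtx a).
        have -> : flip (a, d) = flip (flip (d', a)) by rewrite /flip /= dE.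
        by rewrite !proj_flip proj_small //; lia.
      rewrite proj_small // /floors /descent /= dE divnDr ?dvdnn // divnn /=.
      rewrite !divn_small; try lia; rewrite !modn_small; try lia.
      apply/andP; split; last by lia.
      apply/orP; left; apply/existsP; exists (vtx d'); apply/existsP; exists (vtx a).
      apply/existsP; exists (vtx b); rewrite triangleE; try lia.
      have -> : tri d' a b.
        move: T; rewrite /tri dE !edgeDr (edgeC _ a d') (edgeC _ b d').
        by case: (edge a b) (edge d' b) (edge d' a) => [] [] []; lia.
      by rewrite eqxx !orbT.
  + have -> : b = m.+2 by lia.
    have a0 : a = 0 by lia.
    move=> /eqP[-> ->]; rewrite a0 => hd.
    apply/andP; split.
      rewrite -[proj (0, _)]proj_flip -[proj (1, _)]proj_flip /flip /= !add0n.
      by rewrite add1n external_arrow_proj ?orbT // -[m.+3]/(0 + m.+3) hasdiagD.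
    rewrite -[proj (1, 0 + n)]proj_flip.
    have -> : proj (flip (1, 0 + n)) = (vtx 0, vtx 1).
      have -> : flip (1, 0 + n) = flip (flip (0, 1)) by [].
      by rewrite !proj_flip proj_small.
    rewrite proj_small // /floors /descent /= divnDr ?dvdnn // divnn /=.
    by rewrite !divn_small // !modn_small.
- case/orP=> [/andP[/eqP <-]|/and3P[/eqP bE]].
  + move=> T; have /and5P[ab bd da eab /andP[ebd ead]] := T.
    rewrite !edgeDr edgeDl in eab ebd ead.
    rewrite !proj_small; try lia.
    rewrite /floors /descent /= !divn_small; try lia.
    rewrite !modn_small; try lia; apply/andP; split; last by lia.
    apply/orP; left; apply/existsP; exists (vtx a); apply/existsP; exists (vtx c).
    apply/existsP; exists (vtx b); rewrite triangleE; try lia.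
    have -> : tri a c b by rewrite /tri ebd (edgeC _ a b) eab (edgeC _ c b) ead; lia.
    by rewrite eqxx !orbT.
  + have bE' : b = a.+1 by lia.
    move=> /eqP[dE cE] hd.
    have cE' : c = b by lia.
    rewrite dE cE' bE'; rewrite bE' in hd; rewrite external_arrow_proj ?orbT //=.
    case: (ltnP b.+1 n) => bn'.
      rewrite !proj_small; try lia.
      by rewrite /floors /descent /= !divn_small ?modn_small; lia.
    have -> : a = m.+1 by lia.
    rewrite -[proj (m.+2, _)]proj_flip.
    have -> : proj (flip (m.+2, m.+3)) = (vtx 0, vtx m.+2).
      have -> : flip (m.+2, m.+3) = flip (flip (0, m.+2)) by rewrite /flip /= add0n addnC.
      by rewrite !proj_flip proj_small.
    rewrite proj_small // /floors /descent /= divnn /=.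
    by rewrite !divn_small // !modn_small // ; lia.
Qed.

Lemma step_proj X Y : step X Y ->
  arrow sigma (proj X) (proj Y) /\ floors Y = floors X + descent (proj X) (proj Y).
Proof.
move=> st; have [lX lY] := step_lifted st.
rewrite /arrow !lifted_proj //=.
elim/(@lift_edge_ind m): X Y st {lX lY} => X.
  by move=> Xn Y /(step_small Xn) /andP[-> /eqP].
move=> IH Y st; have [/andP[le1 le2] _] := step_le st.
have Y2 : n <= Y.2 by rewrite /= in le2; lia.
have YE : Y = flip (Y.2 - n, Y.1).
  by rewrite /flip /= subnK // -surjective_pairing.
rewrite YE in st *; rewrite step_flip in st.
by rewrite !proj_flip !floors_flip; have [-> ->] := IH _ st; rewrite addSn.
Qed.

Hypothesis triS : is_triangulation sigma.

Lemma step_iter_flip k X Y : step (iter k flip X) (iter k flip Y) = step X Y.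
Proof. by elim: k => //= k IH; rewrite step_flip. Qed.

Lemma lift_at_step X Y : step X Y ->
  step (lift_at (proj X) 0) (lift_at (proj Y) (descent (proj X) (proj Y))).
Proof.
move=> st; have [lX lY] := step_lifted st; have [_ fl] := step_proj st.
rewrite -(step_iter_flip (floors X)) /lift_at -!iterD addn0 -fl.
by rewrite -!/(lift_at _ _) !(lift_at_proj (sigma := sigma)).
Qed.

(** Since flips preserve steps, it is enough to lift the arrow once and then move this lift to level
    [k]. *)
Lemma arrow_step e f k : arrow sigma e f ->
  step (lift_at e k) (lift_at f (k + descent e f)).
Proof.
move=> /and3P[_ _ ar].
rewrite /lift_at -[in X in step X _](addn0 k) !iterD step_iter_flip.
suff [X [Y [st <- <-]]] : exists X Y, [/\ step X Y, proj X = e & proj Y = f].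
  exact: lift_at_step.
case/orP: ar => [|/existsP[v /and3P[hd /eqP-> /eqP->]]].
  case/existsP=> p /existsP[q /existsP[r /andP[]]].
  move=> T; have /and5P[pq qr _ _ _] := T; have rn := ltn_ord r.
  move: T; rewrite -[p]vtxK -[q]vtxK -[r]vtxK.
  rewrite triangleE // -!proj_small //; try lia.
  move=> T; have T' := tri_rot T; have T'' := tri_rot T'.
  have TR X Y : rot1 X Y -> step X Y by rewrite /step => ->.
  case/or3P=> /eqP[-> ->].
  - exists (p : nat, q : nat), (p : nat, r : nat); split => //.
    by apply: TR; rewrite /rot1 /= eqxx T.
  - exists (flip (p : nat, r : nat)), (flip (q : nat, r : nat)); rewrite !proj_flip.
    by split => //; apply: TR; rewrite /rot1 /= eqxx T''.
  - exists (q : nat, r : nat), (flip (p : nat, q : nat)); rewrite proj_flip.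
    by split => //; apply: TR; rewrite /rot1 /= eqxx T'.
have hdv : hasdiag v by move: hd; rewrite -{1}[v]vtxK.
(* Up to one flip these are [(v, v + n - 1)] and [(v + 1, v + n)], the sides before and after
   [v]. *)
exists (flip (v : nat, v + m.+2)), (flip (flip (v : nat, v.+1))).
rewrite !proj_flip; split.
- by rewrite step_flip /step /rot1 /= hdv !eqxx orbT.
- have -> : ord_pred v = vtx (v + m.+2).
    by rewrite -ord_pred_vtx -addnS vtxD vtxK.
  by rewrite /proj /= vtxK mkEC.
- by rewrite /proj /= -ordS_vtx vtxK.
Qed.
End Arrows.

(** * Existence of paths and path lifting *)

Section Reachability.
Variables (m : nat) (sigma : {set pedge m.+3}).
Local Notation n := m.+3.
Local Notation proj := (proj m).
Local Notation tri := (tri sigma).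
Local Notation flip := (flip m).
Local Notation lifted := (lifted sigma).
Local Notation hasdiag := (hasdiag sigma).
Local Notation rot1 := (rot1 sigma).
Local Notation step := (step sigma).
Hypothesis triS : is_triangulation sigma.

Lemma rot1_step X Y : rot1 X Y -> step X Y.
Proof. by rewrite /step => ->. Qed.

Lemma tri_step a b c : tri a b c -> step (a, b) (a, c).
Proof. by move=> T; apply: rot1_step; rewrite /rot1 /= eqxx T. Qed.

Lemma tri_step2 a b c : tri a b c -> step (a, c) (b, c).
Proof.
move=> T; rewrite -step_flip; apply: tri_step.
exact: tri_rot (tri_rot T).
Qed.

Lemma ext_step a : hasdiag a -> step (a, a + m.+2) (a.+1, a + n).
Proof. by move=> h; apply: rot1_step; rewrite /rot1 /= h !eqxx orbT. Qed.

Lemma ext_step2 a : hasdiag a.+1 -> step (a, a.+1) (a.+1, a.+2).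
Proof.
move=> h; have := ext_step h; rewrite -(step_flip _ (a, a.+1)) /flip /=.
by rewrite [a + _]addnS.
Qed.

Lemma step_unflip X Z : step (flip X) Z -> exists2 X', Z = flip X' & step X X'.
Proof.
move=> st; have [/andP[_ le2] _] := step_le st.
have ZE : Z = flip (Z.2 - n, Z.1).
  by rewrite /flip /= subnK -?surjective_pairing //; rewrite /= in le2; lia.
by exists (Z.2 - n, Z.1) => //; rewrite -step_flip -ZE.
Qed.

Lemma le_edge_flip X Y : le_edge (flip X) (flip Y) = le_edge X Y.
Proof. by rewrite /le_edge /= leq_add2r andbC. Qed.

(** When [(a, b)] is not a side, its first endpoint can advance without passing [b], hence without
    passing the target. A side has no room for this and must move past [b], by the external arrow or
    around the triangle beyond it. *)
Lemma step_towards_far X Y : lifted X -> lifted Y -> X.2 <= Y.1 ->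
  exists2 X', step X X' & le_edge X' Y.
Proof.
case: X Y => [a b] [c d] /and3P[/= ab ba eab] /and3P[/= cd dc ecd] bc.
have [ab1|ab1] : a.+1 < b \/ b = a.+1 by lia.
  have [a' T] := apex triS ab1 ba eab.
  exists (a', b); first exact: tri_step2.
  by case/and5P: T; rewrite /le_edge /=; lia.
case: (boolP (hasdiag b)) => [hd|].
  exists (a.+1, a.+2); first by rewrite ab1 in hd *; apply: ext_step2.
  by rewrite /le_edge /=; lia.
(* Without a diagonal at [b], the third vertex beyond the side has to be [b.+1], since otherwise
   [(b, e)] is a diagonal. *)
move=> nhd; have [|e T] := outer_apex triS ab _ eab; first by lia.
exists (a, e); first exact: tri_step.
have /and5P[_ be ea _ /andP[ebe _]] := T.
have [->|be1] : e = b.+1 \/ b.+1 < e by lia.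
  by rewrite /le_edge /=; lia.
by case/negP: nhd; apply/(hasdiagP triS); exists e; split => //; lia.
Qed.

(** The triangle beyond [(a, b)] cannot reach past [d], or its side opposite to [a] would cross
    [(a, d)]. *)
Lemma step_towards_fan X Y : lifted X -> lifted Y -> X.1 = Y.1 -> X.2 < Y.2 ->
  exists2 X', step X X' & le_edge X' Y.
Proof.
case: X Y => [a b] [c d] lX lY /= ac bd; move: lX lY; rewrite -ac {c ac}.
move=> /and3P[/= ab ba eab] /and3P[/= ad da ead].
have [|e T] := outer_apex triS ab _ eab; first by lia.
exists (a, e); first exact: tri_step.
have /and5P[_ be ea _ /andP[ebe _]] := T.
rewrite /le_edge /= leqnn /= leqNgt; apply/negP => de.
by apply: (@noncross _ _ triS a d b e).
Qed.

(** Dominance leaves few configurations: the target beyond the source, the same after a flip, a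
    common endpoint, or interleaved endpoints, which noncrossing excludes. *)
Lemma step_towards X Y : lifted X -> lifted Y -> le_edge X Y -> X <> Y ->
  exists2 X', step X X' & le_edge X' Y.
Proof.
have unfl U V : (exists2 X', step (flip U) X' & le_edge X' (flip V)) ->
    exists2 X', step U X' & le_edge X' V.
  case=> _ /step_unflip[X' -> st] le; exists X' => //.
  by rewrite -le_edge_flip.
move=> lX lY /andP[le1 le2] neq.
case: (leqP X.2 Y.1) => h1; first exact: step_towards_far.
case: (leqP (X.1 + n) Y.2) => h2.
  by apply: unfl; apply: step_towards_far; rewrite ?lifted_flip.
case: (ltngtP X.1 Y.1) => h3; try lia; case: (ltngtP X.2 Y.2) => h4; try lia.
- case/and3P: lX => ? ? e1; case/and3P: lY => ? ? e2.
  by case: (@noncross _ _ triS X.1 X.2 Y.1 Y.2).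
- by apply: unfl; apply: step_towards_fan; rewrite ?lifted_flip //= ltn_add2r.
- exact: step_towards_fan.
- by case: neq; rewrite (surjective_pairing X) h3 h4 -surjective_pairing.
Qed.

Lemma reach X Y : lifted X -> lifted Y -> le_edge X Y ->
  exists2 s, path step X s & last X s = Y.
Proof.
have [k] := ubnP (Y.1 + Y.2 - (X.1 + X.2)); elim: k X => // k IH X hk lX lY le.
case: (X =P Y) => [->|neq]; first by exists [::].
have [X' st le'] := step_towards lX lY le neq.
have [_ lt] := step_le st; have [_ lX'] := step_lifted st.
have [|s ps ls] := IH X' _ lX' lY le'; last by exists (X' :: s); rewrite //= st.
by case/andP: le; case/andP: le'; lia.
Qed.

Lemma path_step_lifted X s : lifted X -> path step X s -> lifted (last X s).
Proof.
by elim: s X => //= Y s IH X _ /andP[/step_lifted[_ lY]]; exact: IH.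
Qed.

Lemma path_step_le X s : path step X s -> le_edge X (last X s).
Proof.
elim: s X => [|Y s IH] X /=; first by rewrite /le_edge !leqnn.
case/andP=> /step_le[/andP[h1 h2] _] /IH /andP[h3 h4].
by rewrite /le_edge (leq_trans h1) ?(leq_trans h2).
Qed.

Lemma path_proj X s : path step X s -> path (arrow sigma) (proj X) (map proj s).
Proof.
by elim: s X => //= Y s IH X /andP[/step_proj[-> _]] /IH ->.
Qed.

Lemma lift_path (e : pedge n) k s : path (arrow sigma) e s ->
  exists t, path step (lift_at e k) t /\ map proj t = s.
Proof.
elim: s e k => [|f s IH] e k /=; first by exists [::].
case/andP=> ar /(IH f (k + descent e f)) [t [pt <-]].
exists (lift_at f (k + descent e f) :: t); split => /=.
  by rewrite arrow_step.
rewrite proj_lift_at //; apply: (edgeset_lt triS).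
by case/and3P: ar.
Qed.

End Reachability.

(** * Fans of triangles around a vertex and big cycles *)

Section Fans.
Variables (m : nat) (sigma : {set pedge m.+3}).
Local Notation n := m.+3.
Local Notation vtx := (vtx m).
Local Notation proj := (proj m).
Local Notation edge := (edge sigma).
Local Notation tri := (tri sigma).
Local Notation hasdiag := (hasdiag sigma).
Local Notation step := (step sigma).

Definition nbrs a := [seq w <- iota a n | edge a w].

Lemma modn_rotK a i : i < n -> ((a + i) %% n + n - a %% n) %% n = i.
Proof.
move=> ilt; have an := ltn_pmod a (isT : 0 < n).
rewrite -addnBA 1?ltnW // modnDml {1}(divn_eq a n).
move: (a %/ n) (a %% n) an => q r rn.
have -> : q * n + r + i + (n - r) = q.+1 * n + i by lia.
by rewrite modnMDl modn_small.
Qed.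

Lemma modn_rotVK a x : x < n -> (a + (x + n - a %% n) %% n) %% n = x.
Proof.
move=> ilt; have an := ltn_pmod a (isT : 0 < n).
rewrite modnDmr {1}(divn_eq a n).
move: (a %/ n) (a %% n) an => q r rn.
have -> : q * n + r + (x + n - r) = q.+1 * n + x by lia.
by rewrite modnMDl modn_small.
Qed.

(** The sorting key is the anticlockwise distance from [a], so in the cover the sorted list is the
    window [iota a n]. *)
Lemma around_vtx a : around sigma (vtx a) = map vtx (nbrs a).
Proof.
rewrite /around; set r := fun _ _ => _.
suff -> : sort r (enum 'I_n) = map vtx (iota a n) by rewrite filter_map.
have key_inj (x y : 'I_n) :
    (x + n - a %% n) %% n = (y + n - a %% n) %% n -> x = y.
  by move=> h; apply/val_inj; rewrite /= -[x : nat](modn_rotVK a) // h modn_rotVK.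
apply: (sorted_eq (leT := r)).
- by move=> y x z; apply: leq_trans.
- by move=> x y /andP[h1 h2]; apply: key_inj; apply/eqP; rewrite eqn_leq; apply/andP; split.
- by apply: sort_sorted => x y; apply: leq_total.
- rewrite sorted_map -[a in iota a]addn0 iotaDl sorted_map.
  apply/(sortedP 0) => i; rewrite size_iota => ilt.
  rewrite !nth_iota ?add0n; try lia.
  by rewrite /r /= !modn_rotK; lia.
rewrite perm_sort; apply: uniq_perm; first exact: enum_uniq.
  rewrite map_inj_in_uniq ?iota_uniq // => x y; rewrite !mem_iota => hx hy.
  move/(congr1 (fun z : 'I_n => (z + n - a %% n) %% n)).
  by rewrite /= -(subnKC (_ : a <= x)) -1?(subnKC (_ : a <= y)) ?modn_rotK; lia.
move=> x; rewrite mem_enum inE; apply/esym/mapP.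
exists (a + (x + n - a %% n) %% n); last by apply/val_inj; rewrite /= modn_rotVK.
by rewrite mem_iota leq_addr ltn_add2l ltn_pmod.
Qed.

Lemma big_cycle_vtx a : big_cycle sigma (vtx a) = [seq proj (a, w) | w <- nbrs a].
Proof. by rewrite /big_cycle around_vtx -map_comp. Qed.

Hypothesis triS : is_triangulation sigma.

Lemma tri_uniq_in a b b' c : tri a b c -> tri a b' c -> b = b'.
Proof.
move=> /and5P[? ? ? ? /andP[? ?]] /and5P[? ? ? ? /andP[? ?]].
case: (ltngtP b b') => // h; exfalso.
  by apply: (@noncross _ _ triS a b' b c); lia.
by apply: (@noncross _ _ triS a b b' c); lia.
Qed.

(** Consecutive neighbours [w < l] of [a] bound a triangle: the apex over [(a, l)] is itself a
    neighbour of [a], and before [w] its edge to [l] would cross [(a, w)]. *)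
Lemma nbrs_path_aux a w k l :
  a < w -> w < l -> l + k <= a + n -> edge a w ->
  (forall x, w < x -> x < l -> ~~ edge a x) ->
  path (tri a) w [seq x <- iota l k | edge a x].
Proof.
elim: k w l => //= k IH w l aw wl lk ew nb; case: ifP => el /=; last first.
  apply: IH => //; try lia; move=> x wx; rewrite ltnS leq_eqVlt => /orP[/eqP->|].
    by rewrite el.
  exact: nb.
have -> : path (tri a) l [seq x <- iota l.+1 k | edge a x].
  by apply: IH => //; lia.
rewrite andbT.
have [||c T] := apex triS (_ : a.+1 < l) (_ : l < a + n) el; try lia.
have /and5P[ac cl _ eac /andP[ecl _]] := T.
case: (ltngtP c w) => cw.
- by case: (@noncross _ _ triS a w c l) => //; lia.
- by case/negP: (nb c cw cl).
by rewrite -cw.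
Qed.

Lemma nbrsE a : exists s,
  [/\ nbrs a = a.+1 :: s, path (tri a) a.+1 s & last a.+1 s = a + m.+2].
Proof.
exists [seq x <- iota a.+2 m.+1 | edge a x]; split.
- by rewrite /nbrs /= {1}/edge /is_edge eqxx edge_side.
- by apply: nbrs_path_aux; rewrite ?edge_side //; lia.
have -> : iota a.+2 m.+1 = rcons (iota a.+2 m) (a + m.+2).
  by have := iotaD a.+2 m 1; rewrite addn1 cats1 !addSn !addnS => ->.
by rewrite filter_rcons edge_side' last_rcons.
Qed.

Lemma mem_nbrs a w : (w \in nbrs a) = [&& a < w, w < a + n & edge a w].
Proof.
rewrite mem_filter mem_iota andbC -andbA.
case: (ltngtP a w) => //= <-; rewrite /edge /is_edge eqxx /= andbF //.
Qed.

Lemma nbrs_uniq a : uniq (nbrs a).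
Proof. exact/filter_uniq/iota_uniq. Qed.

Lemma nbrs_split a b c : tri a b c -> exists s1 s2, nbrs a = s1 ++ b :: c :: s2.
Proof.
move=> T; have /and5P[ab bc ca eab /andP[_ eac]] := T.
have : c \in nbrs a by rewrite mem_nbrs eac; lia.
have [s [nE p _]] := nbrsE a; rewrite nE inE => /orP[/eqP|cs]; first by lia.
case/splitPr: cs nE p => s1 s2 nE; rewrite cat_path /= => /and3P[_ T' _].
have lE := tri_uniq_in T' T; move: nE; rewrite -cat_cons lastI cat_rcons lE.
by exists (belast a.+1 s1), s2.
Qed.

Lemma fan_path a b s : path (tri a) b s -> path step (a, b) [seq (a, w) | w <- s].
Proof.
by elim: s b => //= c s IH b /andP[/tri_step -> /IH].
Qed.

Lemma fan_path2 a b s : path (tri a) b s -> path step (b, a + n) [seq (w, a + n) | w <- s].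
Proof.
elim: s b => //= c s IH b /andP[T /IH ->]; rewrite andbT.
by have := tri_step T; rewrite -step_flip.
Qed.

(** The path [u] is the big cycle at [a] without the arrow from [(a, b)] to [(a, c)]: it rotates to
    the last side at [a], takes the external arrow, and rotates on to the flip of [(a, b)]. *)
Lemma fan_rotation a b c : tri a b c -> hasdiag a ->
  exists s1 s2, let u := [seq (a, w) | w <- s2] ++ [seq (w, a + n) | w <- rcons s1 b] in
  [/\ nbrs a = s1 ++ b :: c :: s2, path step (a, c) u, last (a, c) u = (b, a + n),
    rot1 sigma (a, c) (head (a, c) u)
    & map proj ((a, c) :: u) = rot (size s1).+1 (big_cycle sigma (vtx a))].
Proof.
move=> T hd; have [s1 [s2 nE]] := nbrs_split T; exists s1, s2 => /=.
have [s [nE' p l]] := nbrsE a.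
have proj2 w : proj (w, a + n) = proj (a, w) by rewrite -[RHS]proj_flip.
split => //; [|by rewrite last_cat map_rcons last_rcons| |]; last 2 first.
- case: (s2) nE => [|d s4] nE; last first.
    move: p; have := nE'; rewrite nE; case: (s1) => [|x s3] /= [_ <-] /=.
      by case/and3P=> _ T' _; rewrite /rot1 /= eqxx T'.
    by rewrite cat_path /= => /and5P[_ _ _ T' _]; rewrite /rot1 /= eqxx T'.
  have lc : c = a + m.+2.
    by rewrite -l -[last _ _]/(last a (a.+1 :: s)) -nE' nE last_cat.
  have -> : head (a, c) ([seq (a, w) | w <- [::]] ++ [seq (w, a + n) | w <- rcons s1 b]) = (a.+1, a + n).
    by have := nE'; rewrite nE -cat_rcons; case: (rcons s1 b) (size_rcons s1 b) => //= x s3 _ [->].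
  by rewrite /rot1 /= lc hd !eqxx orbT.
- rewrite big_cycle_vtx nE -cat_rcons map_cat -(size_rcons s1 b).
  rewrite -(size_map (fun w => proj (a, w))) rot_size_cat /= map_cat -!map_comp.
  by congr (_ :: _ ++ _); apply: eq_map => w /=; rewrite proj2.
- have E1 : rcons s1 b = a.+1 :: behead (rcons s1 b) /\ path (tri a) a.+1 (behead (rcons s1 b)).
    move: p; have := nE'; rewrite nE -cat_rcons; case: (rcons s1 b) (size_rcons s1 b) => //= x s3 _ [-> <-].
    by rewrite cat_path => /andP[].
  case: E1 => -> E1.
  have E2 : path (tri a) c s2 /\ last c s2 = a + m.+2.
    have := nE'; rewrite nE; case: (s1) => [|x s3] /= [_ sE].
      by move: p l; rewrite -sE /= => /andP[_ ->] ->.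
    by move: p l; rewrite -sE cat_path last_cat /= => /and4P[_ _ _ ->] ->.
  rewrite cat_path fan_path /=; last by case: E2.
  rewrite fan_path2 // andbT; case: E2 => _ l2.
  by rewrite (last_map (fun w => (a, w))) l2 ext_step.
Qed.

End Fans.

(** * Linear maps on a free module, determined by the basis *)

Section LinearExtension.
Local Open Scope ring_scope.
Variables (K : fieldType) (T : choiceType).
Local Notation KT := {malg K[T]}.

Section Extension.
Variables (V : lmodType K) (g : T -> V).

Definition lext (u : KT) : V := \sum_(p <- msupp u) u@_p *: g p.

Lemma lextEw (d : {fset T}) (u : KT) : (msupp u `<=` d)%fset ->
  lext u = \sum_(p <- d) u@_p *: g p.
Proof.
move=> le; rewrite [LHS](big_fset_incl _ le) => //= p _ /mcoeff_outdom ->.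
by rewrite scale0r.
Qed.

Lemma lext_is_linear : linear lext.
Proof.
move=> c u v; pose d := (msupp u `|` msupp v `|` msupp (c *: u + v))%fset.
have dP w : w \in [:: u; v; c *: u + v] -> (msupp w `<=` d)%fset.
  by rewrite !inE => /or3P[]/eqP->; apply/fsubsetP => p; rewrite !inE => ->; rewrite ?orbT.
rewrite !(@lextEw d) ?dP ?inE ?eqxx ?orbT //.
rewrite scaler_sumr -big_split /=; apply: eq_bigr => p _.
by rewrite mcoeffD mcoeffZ scalerDl scalerA.
Qed.

HB.instance Definition _ := GRing.isLinear.Build K KT V _ lext lext_is_linear.

Lemma lextU p : lext << p >> = g p.
Proof. by rewrite (lextEw msuppU_le) big_seq_fset1 mcoeffUU scale1r. Qed.

End Extension.

Lemma lext_fun (V : lmodType K) c (g h : T -> V) u :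
  lext (fun p => c *: g p + h p) u = c *: lext g u + lext h u.
Proof.
rewrite /lext scaler_sumr -big_split; apply: eq_bigr => p _ /=.
by rewrite scalerDr !scalerA mulrC.
Qed.

Lemma eq_lext (V : lmodType K) (g h : T -> V) u : g =1 h -> lext g u = lext h u.
Proof. by move=> e; apply: eq_bigr => p _; rewrite e. Qed.

Lemma malgU_scale c p : << c *g p >> = c *: << p >> :> KT.
Proof. by apply/malgP => q; rewrite mcoeffZ !mcoeffU mulrnAr mulr1. Qed.

Lemma malg_lin_ind (P : KT -> Prop) :
  P 0 -> (forall u v, P u -> P v -> P (u + v)) -> (forall c u, P u -> P (c *: u)) ->
  (forall p, P << p >>) -> forall u, P u.
Proof.
move=> P0 PD PZ PU u; rewrite (monalgE u).
apply: big_ind => // p _.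
rewrite malgU_scale; exact: PZ.
Qed.

Lemma malg_linear0 (V : lmodType K) (f : KT -> V) : linear f -> f 0 = 0.
Proof.
move=> lf; have := lf 1 0 0; rewrite scaler0 add0r scale1r => f0.
by apply: (addrI (f 0)); rewrite -f0 addr0.
Qed.

Lemma malg_linearZ (V : lmodType K) (f : KT -> V) : linear f ->
  forall c u, f (c *: u) = c *: f u.
Proof. by move=> lf c u; have := lf c u 0; rewrite addr0 (malg_linear0 lf) addr0. Qed.

Lemma malg_linearD (V : lmodType K) (f : KT -> V) : linear f ->
  forall u v, f (u + v) = f u + f v.
Proof. by move=> lf u v; have := lf 1 u v; rewrite !scale1r. Qed.

Lemma malg_lin_ext (V : lmodType K) (f g : KT -> V) : linear f -> linear g ->
  (forall p, f << p >> = g << p >>) -> f =1 g.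
Proof.
move=> lf lg fg u; elim/malg_lin_ind: u => [|u v hu hv|c u hu|//].
- by rewrite (malg_linear0 lf) (malg_linear0 lg).
- by rewrite (malg_linearD lf) (malg_linearD lg) hu hv.
- by rewrite (malg_linearZ lf) (malg_linearZ lg) hu.
Qed.

End LinearExtension.

(** * The path algebra, the ideal J and congruence of paths *)

Section PathAlgebra.
Local Open Scope ring_scope.
Variables (n : nat) (sigma : {set pedge n}) (K : fieldType).
Local Notation qpath := (qpath sigma).
Local Notation KQ := (KQ sigma K).
Local Notation pathel := (pathel sigma K).
Local Notation arrow := (arrow sigma).

(** Nested linear extensions of concatenation: bilinearity becomes formal and associativity reduces
    to paths. *)
Lemma kqmulE (u v : KQ) : kqmul u v = lext (fun p => lext (fun q => pmul_path K p q) v) u.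
Proof.
rewrite /kqmul /lext; apply: eq_bigr => p _; rewrite scaler_sumr.
by apply: eq_bigr => q _; rewrite scalerA.
Qed.

Lemma kqmulDl (u v w : KQ) : kqmul (u + v) w = kqmul u w + kqmul v w.
Proof. by rewrite !kqmulE linearD. Qed.

Lemma kqmulZl c (u w : KQ) : kqmul (c *: u) w = c *: kqmul u w.
Proof. by rewrite !kqmulE linearZ. Qed.

Lemma kqmul0l (w : KQ) : kqmul 0 w = 0.
Proof. by rewrite !kqmulE linear0. Qed.

Lemma kqmul_linearl (w : KQ) : linear (fun u : KQ => kqmul u w : KQ).
Proof. by move=> c u v; rewrite kqmulDl kqmulZl. Qed.

Lemma kqmul_linear (w : KQ) : linear (kqmul w : KQ -> KQ).
Proof.
move=> c u v; rewrite !kqmulE.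
have E := lext_fun c (fun p => lext (pmul_path K p) u) (fun p => lext (pmul_path K p) v) w.
apply: etrans E.
apply: eq_lext => p.
exact: linearP.
Qed.

Lemma kqmulDr (u v w : KQ) : kqmul w (u + v) = kqmul w u + kqmul w v.
Proof. exact: malg_linearD (kqmul_linear w) u v. Qed.

Lemma kqmul0r (w : KQ) : kqmul w 0 = 0.
Proof. exact: malg_linear0 (kqmul_linear w). Qed.

Lemma kqmulZr c (u w : KQ) : kqmul w (c *: u) = c *: kqmul w u.
Proof. exact: malg_linearZ (kqmul_linear w) c u. Qed.

Lemma kqmulBr (u v w : KQ) : kqmul w (u - v) = kqmul w u - kqmul w v.
Proof. by rewrite -scaleN1r kqmulDr kqmulZr scaleN1r. Qed.

Lemma kqmulBl (u v w : KQ) : kqmul (u - v) w = kqmul u w - kqmul v w.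
Proof. by rewrite -scaleN1r kqmulDl kqmulZl scaleN1r. Qed.

Lemma kqmul_suml I (r : seq I) (P : pred I) (F : I -> KQ) w :
  kqmul (\sum_(i <- r | P i) F i) w = \sum_(i <- r | P i) kqmul (F i) w.
Proof. by elim/big_rec2: _ => [|i x y _ <-]; rewrite ?kqmul0l ?kqmulDl. Qed.

Lemma kqmul_sumr I (r : seq I) (P : pred I) (F : I -> KQ) w :
  kqmul w (\sum_(i <- r | P i) F i) = \sum_(i <- r | P i) kqmul w (F i).
Proof. by elim/big_rec2: _ => [|i x y _ <-]; rewrite ?kqmul0r ?kqmulDr. Qed.

Lemma olast_cons (x : pedge n) s : olast (x :: s) = Some (last x s).
Proof. by rewrite /olast lastI rev_rcons. Qed.

Lemma pathel_out s : ~~ is_qpath sigma s -> pathel s = 0.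
Proof. by move=> h; rewrite /pathel insubN. Qed.

Lemma pathelE (p : qpath) : pathel (val p) = << p >>.
Proof. by rewrite /pathel valK. Qed.

Lemma qpathP (p : qpath) : exists x s,
  [/\ val p = x :: s, x \in edgeset sigma & path arrow x s].
Proof.
by case: p => -[|x s] //= h; exists x, s; case/andP: (h).
Qed.

Lemma mul_pathel x s y t : is_qpath sigma (x :: s) -> is_qpath sigma (y :: t) ->
  kqmul (pathel (x :: s)) (pathel (y :: t)) =
  if last x s == y then pathel (x :: s ++ t) else 0.
Proof.
move=> hs ht; have E r (h : is_qpath sigma r) : pathel r = << Sub r h : qpath >>.
  by rewrite -pathelE SubK.
rewrite (E _ hs) (E _ ht) kqmulE !lextU /pmul_path !SubK olast_cons /=.
by rewrite (inj_eq Some_inj).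
Qed.

Lemma mulA_basis (p q r : qpath) :
  kqmul (<< p >> : KQ) (kqmul << q >> << r >>) = kqmul (kqmul << p >> << q >>) << r >>.
Proof.
have [x [s [pE xe ps]]] := qpathP p; have [y [t [qE ye pt]]] := qpathP q.
have [z [k [rE ze pk]]] := qpathP r.
rewrite -!pathelE pE qE rE.
have qp : is_qpath sigma (x :: s) by rewrite /= xe.
have qq : is_qpath sigma (y :: t) by rewrite /= ye.
have qr : is_qpath sigma (z :: k) by rewrite /= ze.
rewrite (mul_pathel qq qr) (mul_pathel qp qq); case: (eqVneq (last y t) z) => ly; last first.
  rewrite kqmul0r; case: (eqVneq (last x s) y) => lx; last by rewrite kqmul0l.
  have qpq : is_qpath sigma (x :: s ++ t) by rewrite /= xe cat_path ps lx.
  by rewrite (mul_pathel qpq qr) last_cat lx (negbTE ly).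
have qqr : is_qpath sigma (y :: t ++ k) by rewrite /= ye cat_path pt ly.
rewrite (mul_pathel qp qqr); case: (eqVneq (last x s) y) => lx; last by rewrite kqmul0l.
have qpq : is_qpath sigma (x :: s ++ t) by rewrite /= xe cat_path ps lx.
by rewrite (mul_pathel qpq qr) last_cat lx ly eqxx catA.
Qed.

Lemma kqmulA (u v w : KQ) : kqmul u (kqmul v w) = kqmul (kqmul u v) w.
Proof.
have base3 p q : kqmul << p >> (kqmul << q >> w) = kqmul (kqmul << p >> << q >>) w :> KQ.
  apply: (malg_lin_ext (f := fun w => kqmul << p >> (kqmul << q >> w))
            (g := kqmul (kqmul << p >> << q >>))) => [c a b|c a b|r].
  - exact: etrans (congr1 (kqmul _) (kqmul_linear _ _ _ _)) (kqmul_linear _ _ _ _).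
  - exact: kqmul_linear.
  - exact: mulA_basis.
have base2 p : kqmul << p >> (kqmul v w) = kqmul (kqmul << p >> v) w :> KQ.
  apply: (malg_lin_ext (f := fun v => kqmul << p >> (kqmul v w))
            (g := fun v => kqmul (kqmul << p >> v) w)) => [c a b|c a b|q].
  - exact: etrans (congr1 (kqmul _) (kqmul_linearl _ _ _ _)) (kqmul_linear _ _ _ _).
  - exact: etrans (congr1 (fun u : KQ => kqmul u w) (kqmul_linear _ _ _ _)) (kqmul_linearl _ _ _ _).
  - exact: base3.
apply: (malg_lin_ext (f := fun u => kqmul u (kqmul v w))
          (g := fun u => kqmul (kqmul u v) w)) => [c a b|c a b|//].
- exact: kqmul_linearl.
- exact: etrans (congr1 (fun u : KQ => kqmul u w) (kqmul_linearl _ _ _ _)) (kqmul_linearl _ _ _ _).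
Qed.

(** If [y :: s] is not a path, both sides are the default value 0 of [pathel]. *)
Lemma mul_arrow_pathel x y s : arrow x y ->
  kqmul (pathel [:: x; y]) (pathel (y :: s)) = pathel (x :: y :: s).
Proof.
move=> a; have /and3P[xe ye _] := a.
case: (boolP (is_qpath sigma (y :: s))) => h.
  by rewrite mul_pathel /= ?eqxx ?xe ?a.
have h' : ~~ is_qpath sigma (x :: y :: s).
  by apply: contra h => /= /and3P[_ _ ps]; rewrite ye.
by rewrite (pathel_out h) (pathel_out h') kqmul0r.
Qed.

Lemma mul_pathel_cat y s w : path arrow (last y s) w ->
  kqmul (pathel (y :: s)) (pathel (last y s :: w)) = pathel (y :: s ++ w).
Proof.
move=> pw; case: (boolP (is_qpath sigma (y :: s))) => [/= /andP[ye ps]|h].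
  have le : last y s \in edgeset sigma.
    case/lastP: s {pw} ps => //= s x; rewrite rcons_path last_rcons => /andP[_].
    by case/and3P.
  by rewrite mul_pathel /= ?eqxx ?ye ?le.
have h' : ~~ is_qpath sigma (y :: s ++ w).
  by apply: contra h => /= /andP[-> ]; rewrite cat_path => /andP[].
by rewrite (pathel_out h) (pathel_out h') kqmul0l.
Qed.

Local Notation inJ := (@inJ n sigma K).

Lemma inJ0 : inJ 0.
Proof. by exists [::]; rewrite big_nil. Qed.

Lemma inJD u v : inJ u -> inJ v -> inJ (u + v).
Proof.
move=> [s [sa ->]] [t [ta ->]]; exists (s ++ t).
by rewrite all_cat sa ta big_cat.
Qed.

Lemma inJ_mull u v : inJ u -> inJ (kqmul v u).
Proof.
move=> [s [sa ->]]; exists [seq (kqmul v x.1.1, x.1.2, x.2) | x <- s].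
rewrite all_map; split => //; rewrite kqmul_sumr big_map.
by apply: eq_bigr => x _ /=; rewrite !kqmulA.
Qed.

Lemma inJ_mulr u v : inJ u -> inJ (kqmul u v).
Proof.
move=> [s [sa ->]]; exists [seq (x.1.1, x.1.2, kqmul x.2 v) | x <- s].
rewrite all_map; split => //; rewrite kqmul_suml big_map.
by apply: eq_bigr => x _; exact: esym (kqmulA _ _ _).
Qed.

Lemma inJZ c u : inJ u -> inJ (c *: u).
Proof.
move=> [s [sa ->]]; exists [seq (c *: x.1.1, x.1.2, x.2) | x <- s].
rewrite all_map; split => //; rewrite scaler_sumr big_map.
by apply: eq_bigr => x _ /=; rewrite !kqmulZl.
Qed.

Lemma inJN u : inJ u -> inJ (- u).
Proof. by rewrite -scaleN1r; apply: inJZ. Qed.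

Definition eqJ s t := inJ (pathel s - pathel t).

Lemma eqJ_refl s : eqJ s s.
Proof. by rewrite /eqJ subrr; apply: inJ0. Qed.

Lemma eqJ_sym s t : eqJ s t -> eqJ t s.
Proof. by rewrite /eqJ => /inJN; rewrite opprB. Qed.

Lemma eqJ_trans t s w : eqJ s t -> eqJ t w -> eqJ s w.
Proof. by move=> h1 /(inJD h1); rewrite addrA subrK. Qed.

Lemma eqJ_cons x y s t : arrow x y -> eqJ (y :: s) (y :: t) ->
  eqJ (x :: y :: s) (x :: y :: t).
Proof.
move=> a /(inJ_mull (pathel [:: x; y])).
by rewrite kqmulBr !mul_arrow_pathel.
Qed.

Lemma eqJ_cat x s t w : last x s = last x t -> path arrow (last x s) w ->
  eqJ (x :: s) (x :: t) -> eqJ (x :: s ++ w) (x :: t ++ w).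
Proof.
move=> l pw /(@inJ_mulr _ (pathel (last x s :: w))).
by rewrite kqmulBl mul_pathel_cat // l mul_pathel_cat // -l.
Qed.

(** Membership in J asks for a factor on each side of the derivative; the trivial paths at the two
    ends of the relation serve as neutral factors. *)
Lemma inJ_dW a e f u v : rel_arrow sigma a ->
  dW sigma K a = pathel (e :: u) - pathel (e :: v) ->
  last e u = f -> last e v = f -> is_qpath sigma (e :: u) -> is_qpath sigma (e :: v) ->
  eqJ (e :: u) (e :: v).
Proof.
move=> ra dE lu lv qu qv; exists [:: (idem sigma K e, a, idem sigma K f)].
have /andP[ee pu] : is_qpath sigma (e :: u) by [].
have fe : is_qpath sigma [:: f].
  rewrite -lu /= andbT; case/lastP: u {dE lu qu} pu => //= s x.
  by rewrite rcons_path last_rcons => /andP[_ /and3P[]].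
rewrite /= ra; split => //; rewrite big_seq1 /= dE /idem kqmulBr.
have q1 : is_qpath sigma [:: e] by rewrite /= ee.
rewrite !mul_pathel // eqxx kqmulBl /= !mul_pathel // lu lv eqxx !cats0 //.
Qed.

End PathAlgebra.

(** * Cyclic derivatives of cycles without repeated vertices *)

Section CyclicDerivative.
Local Open Scope ring_scope.
Variables (n : nat) (sigma : {set pedge n}) (K : fieldType).

Lemma nth_zip_rot (c : seq (pedge n)) i d : (i < size c)%N ->
  ohead (drop i (zip c (rot 1 c))) = Some (nth d c i, nth d (rot 1 c) i).
Proof.
move=> ic; have sz : size (rot 1 c) = size c by rewrite size_rot.
by rewrite (drop_nth (d, d)) ?size_zip ?sz ?minnn //= nth_zip.
Qed.

(** Without repetitions an arrow is determined in the cycle by its source, so a single summand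
    survives. *)
Lemma cdiff_nth (c : seq (pedge n)) i a d : uniq c -> (i < size c)%N ->
  a = (nth d c i, nth d (rot 1 c) i) ->
  cdiff sigma K c a = pathel sigma K (rot i.+1 c).
Proof.
move=> uc ic ->; rewrite /cdiff (bigD1 (Ordinal ic)) //= (nth_zip_rot d ic) eqxx.
rewrite big1 ?addr0 // => j; rewrite -val_eqE /= => nij.
rewrite (nth_zip_rot d (ltn_ord j)); case: eqP => // -[E _].
by case/negP: nij; rewrite -(nth_uniq d _ ic uc) ?E.
Qed.

Lemma cdiff_notin (c : seq (pedge n)) a :
  ~~ ((a.1 \in c) && (a.2 \in c)) -> cdiff sigma K c a = 0.
Proof.
case: a => e f h; rewrite /cdiff big1 // => i _.
rewrite (nth_zip_rot e (ltn_ord i)); case: eqP => // -[E1 E2]; case/negP: h => /=.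
by rewrite -{1}E1 -E2 mem_nth //= -(mem_rot 1) mem_nth ?size_rot.
Qed.

End CyclicDerivative.

(** * The relation of an arrow as a difference of two paths *)

Section Relations.
Variables (m : nat) (sigma : {set pedge m.+3}) (K : fieldType).
Local Notation n := m.+3.
Local Notation vtx := (vtx m).
Local Notation proj := (proj m).
Local Notation tri := (tri sigma).
Local Notation hasdiag := (hasdiag sigma).
Local Notation step := (step sigma).
Local Notation pathel := (pathel sigma K).
Hypothesis triS : is_triangulation sigma.

(** A lifted triangle becomes sorted only after a cyclic rotation, hence three ways of matching the
    edges. *)
Definition on_triangle (t : 'I_n * 'I_n * 'I_n) a b c :=
  let: (p, q, r) := t in
  [\/ [/\ proj (a, b) = (p, q), proj (a, c) = (p, r) & proj (b, c) = (q, r)],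
      [/\ proj (a, b) = (q, r), proj (a, c) = (p, q) & proj (b, c) = (p, r)]
    | [/\ proj (a, b) = (p, r), proj (a, c) = (q, r) & proj (b, c) = (p, q)]].

Lemma tri_triangle a b c : tri a b c ->
  exists2 t, triangle sigma t.1.1 t.1.2 t.2 & on_triangle t a b c.
Proof.
have [k] := ubnP (a + b + c); elim: k a b c => // k IH a b c hk T.
have /and5P[ab bc ca _ _] := T; case: (ltnP c n) => cn.
  exists (vtx a, vtx b, vtx c); first by rewrite /= triangleE.
  by constructor 1; rewrite !proj_small //; lia.
have cE : c - n + n = c by lia.
have T' : tri (c - n) a b.
  by rewrite -tri_shift cE; apply: tri_rot (tri_rot T).
have P1 x : x < c -> proj (c - n, x) = proj (x, c).
  by move=> _; rewrite /proj /= mkEC -[in RHS]cE vtxD.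
have [|[[p q] r] tr ot] := IH _ _ _ _ T'; first by lia.
exists (p, q, r) => //; move: ot; rewrite /= !P1 //; try lia.
by case=> -[? ? ?]; [constructor 2|constructor 3|constructor 1].
Qed.


(** Two different sides of a triangle already contain its three vertices. *)
Lemma tri_cycle_inj (t t' : 'I_n * 'I_n * 'I_n) e f :
  triangle sigma t.1.1 t.1.2 t.2 -> triangle sigma t'.1.1 t'.1.2 t'.2 -> e != f ->
  e \in tri_cycle t.1.1 t.1.2 t.2 -> f \in tri_cycle t.1.1 t.1.2 t.2 ->
  e \in tri_cycle t'.1.1 t'.1.2 t'.2 -> f \in tri_cycle t'.1.1 t'.1.2 t'.2 -> t' = t.
Proof.
move: t t' e f => [[p q] r] [[p' q'] r'] [e1 e2] [f1 f2] /=.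
move=> /and3P[pq qr _] /and3P[pq' qr' _].
rewrite /tri_cycle !inE !xpair_eqE -!val_eqE /= => nef he hf he' hf'.
have [] : p = p' :> nat /\ q = q' :> nat /\ r = r' :> nat by lia.
by move=> /val_inj -> [/val_inj -> /val_inj ->].
Qed.

Lemma mkE_eq (i j k l : 'I_n) : mkE i j = mkE k l -> (i = k /\ j = l) \/ (i = l /\ j = k).
Proof. by rewrite /mkE; case: ifP => _; case: ifP => _ [-> ->]; auto. Qed.

Lemma vtx_neq a b : a < b -> b < a + n -> vtx a <> vtx b.
Proof.
move=> ab ban /(congr1 (@nat_of_ord _)) /= /eqP.
have -> : b = b - a + a by lia.
by rewrite -{1}(add0n a) eqn_modDr mod0n modn_small; lia.
Qed.

Lemma big_cycle_center v a b c : a < b -> b < c -> c < a + n ->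
  proj (a, b) \in big_cycle sigma v -> proj (a, c) \in big_cycle sigma v -> v = vtx a.
Proof.
move=> ab bc ca /mapP[w _ /mkE_eq/= h1] /mapP[w' _ /mkE_eq/= h2].
have n1 : vtx b <> vtx c by apply: vtx_neq; lia.
by case: h1 h2 => -[h1 h1'] [] -[h2 h2'] //; case: n1; congruence.
Qed.

Lemma proj_inj a b c : a < b -> b < a + n -> a < c -> c < a + n ->
  proj (a, b) = proj (a, c) -> b = c.
Proof.
move=> ab ba ac ca /mkE_eq/= h.
case: (ltngtP b c) => // bc; exfalso.
  have : vtx b <> vtx c by apply: vtx_neq; lia.
  by case: h => -[? ?]; congruence.
have : vtx c <> vtx b by apply: vtx_neq; lia.
by case: h => -[? ?]; congruence.
Qed.

Lemma big_cycle_uniq a : uniq (big_cycle sigma (vtx a)).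
Proof.
rewrite big_cycle_vtx map_inj_in_uniq ?nbrs_uniq // => b c.
by rewrite !mem_nbrs => /and3P[? ? _] /and3P[? ? _]; apply: proj_inj.
Qed.

(** The arrow lies on exactly one cyclic triangle and, its two edges meeting only at [a], on exactly
    one big cycle; each sum in the potential contributes one path. *)
Lemma dW_proj a b c s1 s2 : tri a b c -> hasdiag a -> nbrs sigma a = s1 ++ b :: c :: s2 ->
  dW sigma K (proj (a, b), proj (a, c)) =
  (pathel [:: proj (a, c); proj (b, c); proj (a, b)]
   - pathel (rot (size s1).+1 (big_cycle sigma (vtx a))))%R.
Proof.
move=> T hd nE; have /and5P[ab bc ca _ _] := T.
have nef : proj (a, b) != proj (a, c).
  by apply/eqP => /proj_inj; lia.
rewrite /dW; congr (_ - _)%R.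
  have [t tr ot] := tri_triangle T; rewrite (bigD1 t) //=.
  rewrite big1 ?addr0 => [|t' /andP[tr' nt]]; last first.
    apply: cdiff_notin; apply: contra nt => /= /andP[h1 h2]; apply/eqP.
    apply: (tri_cycle_inj tr tr' nef) => //; move: ot; case: (t) => [[p q] r];
    by case=> -[E1 E2 _]; rewrite ?E1 ?E2 !inE eqxx ?orbT.
  move: tr ot; case: t => [[p q] r] /= /and3P[pq qr _] ot.
  have ut : uniq (tri_cycle p q r).
    by rewrite /tri_cycle /= !inE !xpair_eqE -!val_eqE /=; lia.
  (* According to the matching, the arrow starts at position 0, 2 or 1 of the sorted cycle. *)
  case: ot => -[-> -> ->].
  - by rewrite (@cdiff_nth _ _ _ _ 0 _ (p, q)).
  - by rewrite (@cdiff_nth _ _ _ _ 2 _ (p, q)).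
  - by rewrite (@cdiff_nth _ _ _ _ 1 _ (p, q)).
rewrite (bigD1 (vtx a)) //= big1 ?addr0 => [|v /andP[_ nv]]; last first.
  apply: cdiff_notin; apply: contra nv => /= /andP[h1 h2].
  by apply/eqP; apply: (big_cycle_center ab bc ca).
rewrite (@cdiff_nth _ _ _ _ (size s1) _ (proj (a, b))) ?big_cycle_uniq //.
  by rewrite big_cycle_vtx nE size_map size_cat /=; lia.
rewrite big_cycle_vtx nE; congr (_, _).
  by rewrite map_cat nth_cat size_map ltnn subnn.
rewrite map_cat /=; case: (s1) => [|w s3] //=.
by rewrite rot1_cons -cats1 -catA nth_cat size_map ltnNge leqnSn /= subSnn.
Qed.

(** Lifted form of the relation: both terms run from [(a, c)] to [(b, a + n)], one first rotating
    about [c], the other about [a]. *)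
Lemma thin_relation a b c : tri a b c -> hasdiag a ->
  exists u, [/\ path step (a, c) u, last (a, c) u = (b, a + n),
    rot1 sigma (a, c) (head (a, c) u) &
    dW sigma K (proj (a, b), proj (a, c)) =
      (pathel (map proj [:: (a, c); (b, c); (b, a + n)]) - pathel (map proj ((a, c) :: u)))%R].
Proof.
move=> T hd; have [s1 [s2 [nE pu lu hu mu]]] := fan_rotation triS T hd.
eexists; split; [exact: pu|exact: lu|exact: hu|].
have pE : proj (b, a + n) = proj (a, b) by rewrite -[RHS]proj_flip.
by rewrite mu (dW_proj T hd nE) /= pE.
Qed.

End Relations.

(** * Uniqueness of paths modulo J *)

Section Thinness.
Variables (m : nat) (sigma : {set pedge m.+3}) (K : fieldType).
Local Notation n := m.+3.
Local Notation proj := (proj m).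
Local Notation tri := (tri sigma).
Local Notation flip := (flip m).
Local Notation lifted := (lifted sigma).
Local Notation hasdiag := (hasdiag sigma).
Local Notation rot1 := (rot1 sigma).
Local Notation step := (step sigma).
Local Notation eqJ := (@eqJ _ sigma K).
Hypothesis triS : is_triangulation sigma.

Lemma tri_lifted a b c : tri a b c -> [/\ lifted (a, b), lifted (a, c) & lifted (b, c)].
Proof.
by case/and5P=> ? ? ? e1 /andP[e2 e3]; rewrite /lifted /= e1 e2 e3; split; lia.
Qed.

Lemma nonside_hasdiag a b c : tri a b c ->
  ~~ (side (proj (a, b)) && side (proj (a, c))) -> hasdiag a.
Proof.
move=> T; have [l1 l2 _] := tri_lifted T; rewrite !(side_proj (sigma := sigma)) //= => ns.
have /and5P[ab bc ca eab /andP[_ eac]] := T.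
apply/(hasdiagP triS); case: (boolP ((b == a.+1) || (b == a + m.+2))) => h.
  by exists c; split=> //; lia.
by exists b; split=> //; lia.
Qed.

(** External arrows join two sides and so carry no relation; an internal arrow that carries one has
    a diagonal among its ends, and this diagonal meets the common vertex [a]. *)
Lemma rel_arrow_tri al : rel_arrow sigma al -> exists a b c,
  [/\ tri a b c, hasdiag a & al = (proj (a, b), proj (a, c))].
Proof.
case: al => e f /andP[/= ar ns]; have st := arrow_step 0 ar.
have [ee fe _] := and3P ar.
have eE k := proj_lift_at k (edgeset_lt triS ee).
have fE k := proj_lift_at k (edgeset_lt triS fe).
have rotE X Y : proj X = e -> proj Y = f -> rot1 X Y -> exists a b c,
    [/\ tri a b c, hasdiag a & (e, f) = (proj (a, b), proj (a, c))].
  move=> XE YE r; have [lX lY] := rot1_lifted r.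
  case: X Y XE YE r lX lY => [a b] [a' c] XE YE; rewrite /rot1 /=.
  case/orP=> [/andP[/eqP aE T] _ _|/and3P[bE /eqP[aE cE] _] lX lY].
    rewrite -aE in YE; exists a, b, c; split; rewrite -?XE -?YE //.
    by apply: (nonside_hasdiag T); rewrite XE YE.
  by case/negP: ns; rewrite /frozen -XE -YE !(side_proj (sigma := sigma)) //= bE aE cE; lia.
by case/orP: st => /rotE[]; rewrite ?proj_flip ?eE ?fE //; move=> a h; exists a.
Qed.

(** Two different steps out of a lift must therefore rotate it about different endpoints. *)
Lemma rot1_det X Y Z : rot1 X Y -> rot1 X Z -> Y = Z.
Proof.
case: X Y Z => [a b] [c d] [e f]; rewrite /rot1 /=.
case/orP=> [/andP[/eqP <- T]|/and3P[/eqP bE /eqP-> _]];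
case/orP=> [/andP[/eqP <- T']|/and3P[/eqP bE' /eqP-> _]] //.
- by rewrite (tri_uniq_out triS T T').
- by case/and5P: T; lia.
- by case/and5P: T'; lia.
Qed.

Lemma flip_inj : injective flip.
Proof. by move=> [a b] [c d] [-> /eqP]; rewrite eqn_add2r => /eqP ->. Qed.

Lemma map_proj_flip s : map proj (map flip s) = map proj s.
Proof. by rewrite -map_comp; apply: eq_map => X; apply: proj_flip. Qed.

Lemma path_step_flip X s : path step (flip X) (map flip s) = path step X s.
Proof. by elim: s X => //= Y s IH X; rewrite step_flip IH. Qed.

Definition height (X : lift_edge) := X.1 + X.2.

Definition thin_upto k := forall X s t, path step X s -> path step X t ->
  last X s = last X t -> height (last X s) - height X < k ->
  eqJ (map proj (X :: s)) (map proj (X :: t)).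

Lemma path_step_height X Y s : step X Y -> path step Y s -> height X < height (last Y s).
Proof.
move=> /step_le[_ h] /path_step_le /andP[h1 h2]; rewrite /height; lia.
Qed.

(* The relation of the arrow [(a, b) -> (a, c)] closes the square formed by the
   two arrows out of [(a, c)], provided the target has passed [(b, a + n)]. *)
Lemma thin_branch_half k a b c A s t : thin_upto k -> tri a b c ->
  rot1 (a, c) A -> path step A s -> path step (b, c) t ->
  last A s = last (b, c) t -> a + n <= (last A s).2 ->
  height (last A s) - height (a, c) < k.+1 ->
  eqJ (map proj [:: (a, c), A & s]) (map proj [:: (a, c), (b, c) & t]).
Proof.
move=> IH T rA ps pt lst an hk; have /and5P[ab bc ca eab /andP[ebc eac]] := T.
have [l1 l2 l3] := tri_lifted T.
(* If both edges were sides, the first step [A] could only be the external arrow at [a], which needs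
   a diagonal there; that diagonal would cross [(b, c)]. *)
have ns : ~~ (side (proj (a, b)) && side (proj (a, c))).
  apply/negP; rewrite !(side_proj (sigma := sigma)) //= => h.
  have {}h : b = a.+1 /\ c = a + m.+2 by move: h ab bc ca; clear; lia.
  case: h => bE cE; move: rA; rewrite /rot1 /= => /orP[/andP[_ /and5P[_ cA Aa _ _]]|/and3P[_ _]].
    by exfalso; move: cE cA Aa; clear; lia.
  case/(hasdiagP triS) => w [aw wa eaw].
  by apply: (@noncross _ _ triS a w b c) => //; move: aw wa bE cE; clear; lia.
have hd := nonside_hasdiag T ns.
have [u [pu lu ru dE]] := thin_relation K triS T hd.
have pBZ : path step (a, c) [:: (b, c); (b, a + n)].
  by rewrite /= tri_step2 //= tri_step // tri_rot.
have ra : rel_arrow sigma (proj (a, b), proj (a, c)).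
  by rewrite /rel_arrow (step_proj (tri_step T)).1.
have qp x : path step (a, c) x -> is_qpath sigma (proj (a, c) :: map proj x).
  by move=> px; rewrite /= (lifted_proj l2) path_proj.
have rel := inJ_dW ra dE erefl _ (qp _ pBZ) (qp _ pu).
rewrite !last_map lu /= in rel.
have {}rel := rel erefl.
have lZ : lifted (b, a + n) by rewrite -lu; apply: path_step_lifted pu.
have lY : lifted (last A s).
  by apply: path_step_lifted ps; case: (rot1_lifted rA).
have leZ : le_edge (b, a + n) (last A s).
  by rewrite /le_edge an andbT lst; case/andP: (path_step_le pt).
(* Both given paths are compared with paths through [(b, a + n)], the far corner of the square. *)
have [r pr lr] := reach triS lZ lY leZ.
clear dE; case: u pu lu ru rel => [|A' u] pu lu ru rel.
  by case: lu => aE _; rewrite aE ltnn in ab.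
rewrite /= in ru; have AE := rot1_det ru rA; rewrite {}AE in pu lu rel.
have /andP[stA pu'] : step (a, c) A && path step A u := pu.
have lu' : last A u = (b, a + n) := lu.
have h1 : height (a, c) < height A by case: (step_le stA).
have h3 : height A <= height (last A s) by case/andP: (path_step_le ps) => *; apply: leq_add.
have h4 : height (b, c) <= height (last A s).
  by rewrite lst; case/andP: (path_step_le pt) => *; apply: leq_add.
have h2 : height (a, c) < height (b, c) by rewrite /height ltn_add2r.
apply: (eqJ_trans (t := map proj ((a, c) :: A :: u ++ r))).
  apply: eqJ_cons; first by case: (step_proj stA).
  apply: IH => //.
  - by rewrite cat_path pu' lu'.
  - by rewrite last_cat lu' lr.
  - by move: h1 h3 hk; clear; lia.
apply: (eqJ_trans (t := map proj [:: (a, c), (b, c), (b, a + n) & r])).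
  apply: eqJ_sym; rewrite !map_cons map_cat.
  apply: (eqJ_cat (s := [:: _; _]) (t := map proj (A :: u))) => //.
  - by rewrite last_map lu.
  - by rewrite /= path_proj.
apply: eqJ_cons; first by case: (step_proj (tri_step2 T)).
apply: (IH (b, c) ((b, a + n) :: r) t) => //.
- by rewrite /= pr andbT; case/and3P: pBZ.
- by rewrite /= lr lst.
- by rewrite /= lr; move: h2 h4 hk; clear; lia.
Qed.

Lemma rot1_flipE a c B : a.+1 < c -> rot1 (c, a + n) (flip B) ->
  exists2 b, B = (b, c) & tri a b c.
Proof.
case: B => b d ac; rewrite /rot1 /=.
case/orP=> [/andP[/eqP <- T]|]; last by lia.
by exists b => //; rewrite -(tri_shift sigma a b c); apply: tri_rot.
Qed.

(** With [X = (a, c)], a target whose first endpoint stays before [c] and whose second stays before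
    [a + n] would cross [X]. So one of the two has been passed, and the half case applies to [X] or
    to its flip. *)
Lemma thin_branch k X A B s t : thin_upto k ->
  rot1 X A -> rot1 (flip X) (flip B) -> path step A s -> path step B t ->
  last A s = last B t -> height (last A s) - height X < k.+1 ->
  eqJ (map proj [:: X, A & s]) (map proj [:: X, B & t]).
Proof.
case: X => a c IH rA rB ps pt lst hk.
have [/and3P[/= ac ca eac] lA] := rot1_lifted rA.
have lB : lifted B by have [_] := rot1_lifted rB; rewrite lifted_flip.
have /andP[leA1 leA2] := path_step_le ps.
have /andP[leB1 leB2] := path_step_le pt; rewrite -lst in leB1 leB2.
have far2 : c.+1 < a + n -> exists2 d, A = (a, d) & tri a c d.
  move=> ?; case: A rA {ps hk lst leA1 leA2 leB1 leB2 lA} => a' d; rewrite /rot1 /=.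
  by case/orP=> [/andP[/eqP <- T]|]; [exists d | lia].
have [y1|y1] : (c <= (last A s).1 /\ c.+1 < a + n) \/ ~ (c <= (last A s).1 /\ c.+1 < a + n) by lia.
  have [d AE T] := far2 y1.2; apply: eqJ_sym.
  have := @thin_branch_half k c d (a + n) (flip B) (map flip t) (map flip s) IH.
  rewrite (_ : (d, a + n) = flip A); last by rewrite AE.
  rewrite !path_step_flip !last_map -lst.
  rewrite (_ : (c, a + n) = flip (a, c)) // !map_cons !map_proj_flip !proj_flip.
  apply => //; first exact: tri_rot.
    by rewrite /= leq_add2r; case: y1.
  by move: hk; rewrite /height /=; lia.
have [y2|y2] : (a + n <= (last A s).2 /\ a.+1 < c) \/ ~ (a + n <= (last A s).2 /\ a.+1 < c) by lia.
  have [b BE T] := rot1_flipE y2.2 rB; rewrite BE in pt lst *.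
  by apply: (@thin_branch_half k) => //; case: y2.
(* When [(a, c)] is a side, one of the two steps is the external arrow, and following it already
   takes the target past the endpoint in question. *)
have [cE|cE] : c = a.+1 \/ a.+1 < c by lia.
  case: y1; split; last by lia.
  move: rB; rewrite /rot1 /=; case/orP=> [/andP[_ /and5P[]]|/and3P[_ /eqP[B2 B1] _]]; lia.
have [cE'|cE'] : c = a + m.+2 \/ c.+1 < a + n by lia.
  case: y2; split => //.
  apply: leq_trans leA2; move: rA; rewrite /rot1 /= cE'.
  by case/orP=> [/andP[_ /and5P[? ? ? _ _]]|/and3P[_ /eqP-> _]] //; lia.
have [d AE Td] := far2 cE'; have [b BE Tb] := rot1_flipE cE rB.
have /and3P[_ _ eY] := path_step_lifted lA ps.
move: leA1 leA2 leB1 leB2 y1 y2 eY; move: (last A s) => Y; rewrite AE BE /=.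
case/and5P: Td => _ cd _ _ _; case/and5P: Tb => ab _ _ _ _ => _ h1 h2 _ y1 y2 eY.
by exfalso; apply: (@noncross _ _ triS a c Y.1 Y.2) => //; move: y1 y2 h1 h2 cd ab cE cE'; clear; lia.
Qed.

Lemma thin_all k : thin_upto k.
Proof.
elim: k => // k IH X [|A s] [|B t].
- by move=> *; apply: eqJ_refl.
- move=> _ /= /andP[stB pt] E; have := path_step_height stB pt.
  by rewrite -E ltnn.
- move=> /= /andP[stA ps] _ E; have := path_step_height stA ps.
  by rewrite E ltnn.
move=> /= /andP[stA ps] /andP[stB pt] lst hk.
have same : A = B -> eqJ (map proj [:: X, A & s]) (map proj [:: X, B & t]).
  move=> AB; rewrite -AB in pt lst *; apply: eqJ_cons; first by case: (step_proj stA).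
  apply: IH => //; have [_ h] := step_le stA.
  by have := path_step_height stA ps; move: h hk; rewrite /height; lia.
case/orP: (stA) (stB) => rA /orP[] rB.
- exact: same (rot1_det rA rB).
- exact: (thin_branch IH rA rB ps pt lst hk).
- by apply/eqJ_sym/(thin_branch IH rB rA pt ps (esym lst)); rewrite -lst.
- exact: same (flip_inj (rot1_det rA rB)).
Qed.

Lemma thin X s t : path step X s -> path step X t -> last X s = last X t ->
  eqJ (map proj (X :: s)) (map proj (X :: t)).
Proof. by move=> ps pt e; apply: (@thin_all (height (last X s)).+1) => //; lia. Qed.

End Thinness.

(** * Weights of paths as a polynomial matrix representation *)

Section Weights.
Variables (m : nat) (sigma : {set pedge m.+3}) (K : fieldType).
Local Notation n := m.+3.
Local Notation proj := (proj m).
Local Notation tri := (tri sigma).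
Local Notation flip := (flip m).
Local Notation hasdiag := (hasdiag sigma).
Local Notation step := (step sigma).
Local Notation floors := (floors m).
Local Notation arrow := (arrow sigma).
Hypothesis triS : is_triangulation sigma.

(** Counts the flips gained by any lift of the path, without choosing one. *)
Definition pweight (x : pedge n) s := sumn (pairmap (@descent m) x s).

Definition weight (s : seq (pedge n)) := if s is x :: s' then pweight x s' else 0.

Lemma pweight_cat x s t : pweight x (s ++ t) = pweight x s + pweight (last x s) t.
Proof. by rewrite /pweight pairmap_cat sumn_cat. Qed.

Lemma floors_last X s : path step X s ->
  floors (last X s) = floors X + weight (map proj (X :: s)).
Proof.
rewrite /weight /pweight; elim: s X => [|Y s IH] X /=; first by rewrite addn0.
by case/andP=> /step_proj[_ fl] /IH ->; rewrite fl addnA.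
Qed.

Definition cweight (c : seq (pedge n)) := if c is x :: s then pweight x (rcons s x) else 0.

Lemma cweight_rot k c : cweight (rot k c) = cweight c.
Proof.
elim: k => [|k IH]; first by rewrite rot0.
case: (ltnP k (size c)) => kc; last by rewrite rot_oversize // ltnW.
rewrite rotS // -IH; case: (rot k c) => //= x s; rewrite rot1_cons.
case: s => //= y s; rewrite -[RHS]/(descent x y + pweight y (rcons s x)).
by rewrite -[in LHS]cats1 pweight_cat last_rcons /pweight /= addn0 addnC.
Qed.

(** A minimal cycle lifts to a path from some lift to its own flip, one level higher. *)
Lemma min_cycle_props c : min_cycle sigma c -> cycle arrow c /\ cweight c = 1.
Proof.
have lifted_cycle X s : path step X (rcons s (flip X)) ->
    cycle arrow (map proj (X :: s)) /\ cweight (map proj (X :: s)) = 1.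
  move=> p; have := path_proj p; rewrite map_rcons proj_flip => pp.
  split; first exact: pp.
  have := floors_last p; rewrite last_rcons floors_flip /= map_rcons proj_flip.
  by lia.
case=> [[p [q [r [T ->]]]]|[v [hd ->]]].
  have /and3P[pq qr _] := T; have rn := ltn_ord r.
  have T' : tri p q r.
    by rewrite -triangleE // !vtxK.
  have := @lifted_cycle (p : nat, q : nat) [:: (p : nat, r : nat); (q : nat, r : nat)].
  rewrite /= !proj_small ?vtxK //; try lia; apply.
  by rewrite tri_step // tri_step2 // tri_step // tri_rot.
have [s [nE p l]] := nbrsE triS v.
have := @lifted_cycle (v : nat, v.+1) [seq (v : nat, w) | w <- s].
rewrite -[v in big_cycle _ v]vtxK big_cycle_vtx nE /= -map_comp; apply.
rewrite rcons_path fan_path //= (last_map (fun w => (v : nat, w))) l.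
by apply: ext_step; rewrite /hasdiag vtxK.
Qed.

Lemma min_cycle_at_path i c : min_cycle_at sigma i c ->
  exists s, [/\ c = i :: s, last i s = i, path arrow i s & pweight i s = 1].
Proof.
case=> cyc [k [/min_cycle_props[cy cw] _ hd ->]].
have cy' : cycle arrow (rot k cyc) by rewrite rot_cycle.
have := cweight_rot k cyc; rewrite cw.
case: (rot k cyc) hd cy' => //= x s [->] cy' w.
by exists (rcons s i); rewrite last_rcons.
Qed.

Local Open Scope ring_scope.
Local Notation qpath := (qpath sigma).
Local Notation KQ := (KQ sigma K).
Local Notation pathel := (pathel sigma K).

Definition monom_of (e f : pedge n) (s : seq (pedge n)) : {poly K} :=
  if (ohead s == Some e) && (olast s == Some f) then 'X^(weight s) else 0.

(** One entry of a multiplicative map from the path algebra to matrices over [{poly K}], in which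
    the variable records the weight. *)
Definition weight_poly e f : KQ -> {poly K} := lext (fun p : qpath => monom_of e f (val p)).

Lemma weight_poly_linear e f : linear (weight_poly e f).
Proof. exact: lext_is_linear. Qed.

Lemma weight_polyD e f u v : weight_poly e f (u + v) = weight_poly e f u + weight_poly e f v.
Proof. exact: malg_linearD (weight_poly_linear e f) u v. Qed.

Lemma weight_poly0 e f : weight_poly e f 0 = 0.
Proof. exact: malg_linear0 (weight_poly_linear e f). Qed.

Lemma weight_polyZ e f c u : weight_poly e f (c *: u) = c *: weight_poly e f u.
Proof. exact: malg_linearZ (weight_poly_linear e f) c u. Qed.

Lemma weight_polyB e f u v : weight_poly e f (u - v) = weight_poly e f u - weight_poly e f v.
Proof. by rewrite -scaleN1r weight_polyD weight_polyZ scaleN1r. Qed.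

Lemma weight_poly_sum e f I (r : seq I) (P : pred I) (F : I -> KQ) :
  weight_poly e f (\sum_(i <- r | P i) F i) = \sum_(i <- r | P i) weight_poly e f (F i).
Proof. by elim/big_rec2: _ => [|i x y _ <-]; rewrite ?weight_poly0 ?weight_polyD. Qed.

Lemma weight_poly_pathel e f s : weight_poly e f (pathel s) = if is_qpath sigma s then monom_of e f s else 0.
Proof.
case: ifPn => [h|h]; last by rewrite pathel_out ?weight_poly0.
have -> : s = val (Sub s h : qpath) by rewrite SubK.
by rewrite pathelE /weight_poly lextU.
Qed.

Lemma weight_poly_path e f x s : is_qpath sigma (x :: s) ->
  weight_poly e f (pathel (x :: s)) =
  if (x == e) && (last x s == f) then 'X^(pweight x s) else 0.
Proof.
move=> h; rewrite weight_poly_pathel h /monom_of olast_cons /=.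
by rewrite !(inj_eq Some_inj).
Qed.

Lemma weight_poly_mul e f (u v : KQ) : weight_poly e f (kqmul u v) = \sum_g weight_poly e g u * weight_poly g f v.
Proof.
have basis p q : weight_poly e f (kqmul << p >> << q >>) = \sum_g weight_poly e g << p >> * weight_poly g f << q >>.
  have [x [s [pE xe ps]]] := qpathP p; have [y [t [qE ye pt]]] := qpathP q.
  have hs : is_qpath sigma (x :: s) by rewrite /= xe.
  have ht : is_qpath sigma (y :: t) by rewrite /= ye.
  rewrite -!pathelE pE qE (mul_pathel _ hs ht) (bigD1 (last x s)) //= big1 => [|g ng].
    rewrite addr0 !weight_poly_path //= eqxx andbT [y == last x s]eq_sym.
    case: (eqVneq (last x s) y) => [lx|_]; last by rewrite weight_poly0 mulr0.
    rewrite weight_poly_path /= ?xe ?cat_path ?lx ?ps //= last_cat lx pweight_cat lx.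
    by case: (x == e) => /=; rewrite ?mul0r //; case: ifP; rewrite ?mulr0 // exprD.
  by rewrite weight_poly_path // [last x s == g]eq_sym (negbTE ng) andbF mul0r.
have right p : weight_poly e f (kqmul << p >> v) = \sum_g weight_poly e g << p >> * weight_poly g f v.
  apply: (malg_lin_ext (f := fun v => weight_poly e f (kqmul << p >> v))
            (g := fun v => \sum_g weight_poly e g << p >> * weight_poly g f v)) => [c a b|c a b|q].
  - exact: etrans (congr1 (weight_poly e f) (kqmul_linear _ _ _ _)) (weight_poly_linear _ _ _ _ _).
  - rewrite scaler_sumr -big_split; apply: eq_bigr => g _.
    by rewrite (weight_poly_linear g f c a b) mulrDr scalerAr.
  - exact: basis.
apply: (malg_lin_ext (f := fun u => weight_poly e f (kqmul u v))
          (g := fun u => \sum_g weight_poly e g u * weight_poly g f v)) => [c a b|c a b|q].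
- exact: etrans (congr1 (weight_poly e f) (kqmul_linearl _ _ _ _)) (weight_poly_linear _ _ _ _ _).
- rewrite scaler_sumr -big_split; apply: eq_bigr => g _.
  by rewrite (weight_poly_linear e g c a b) mulrDl scalerAl.
- exact: right.
Qed.

(** The two terms lift to paths with the same ends, so they gain the same number of flips and
    cancel. *)
Lemma weight_poly_dW e f al : rel_arrow sigma al -> weight_poly e f (dW sigma K al) = 0.
Proof.
case/(rel_arrow_tri triS) => a [b [c [T hd ->]]].
have [u [pu lu _ ->]] := thin_relation K triS T hd.
have pBZ : path step (a, c) [:: (b, c); (b, a + n)%N].
  by rewrite /= tri_step2 //= tri_step // tri_rot.
have qp x : path step (a, c) x -> is_qpath sigma (proj (a, c) :: map proj x).
  by move=> px; rewrite /= path_proj // andbT; case: (tri_lifted T) => _ /lifted_proj.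
have E := floors_last pu; rewrite lu [LHS](floors_last pBZ) in E.
rewrite weight_polyB [X in X - _](weight_poly_path _ _ (qp _ pBZ)) [X in _ - X](weight_poly_path _ _ (qp _ pu)).
rewrite !last_map lu; move/addnI: E; rewrite /weight => /= ->.
by rewrite subrr.
Qed.

Lemma weight_poly_inJ e f u : inJ u -> weight_poly e f u = 0.
Proof.
case=> s [/allP sa ->]; rewrite weight_poly_sum big_seq big1 // => x /sa ra.
rewrite weight_poly_mul big1 // => g _; rewrite weight_poly_mul big1 ?mul0r // => h _.
by rewrite weight_poly_dW ?mulr0.
Qed.

Lemma weight_poly_eF e f : weight_poly e f (eF sigma K) = ((e == f) && frozen e)%:R.
Proof.
rewrite weight_poly_sum; have gE g : frozen g -> weight_poly e f (idem sigma K g) = ((g == e) && (g == f))%:R.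
  move=> fg; rewrite /idem weight_poly_path /= ?side_edgeset // /pweight /=.
  by case: ifP.
rewrite (eq_bigr _ gE); case: (boolP (frozen e)) => fe.
  rewrite (bigD1 e) //= eqxx big1 ?addr0 ?andbT // => g /andP[_ /negbTE->] //.
rewrite andbF big1 // => g fg; case: eqP => // ge.
by rewrite -ge fg in fe.
Qed.

Lemma weight_poly_FF e f u : inFF u -> ~~ frozen e || ~~ frozen f -> weight_poly e f u = 0.
Proof.
move=> <- nf; rewrite weight_poly_mul big1 // => g _.
rewrite weight_poly_eF; case: eqP => [->|_]; last by rewrite mulr0.
rewrite weight_poly_mul mulr_suml big1 // => h _; rewrite weight_poly_eF.
by case: eqP => [<-|_]; case/orP: nf => /negbTE ->; rewrite /= ?(mulr0, mul0r).
Qed.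

End Weights.

(** * Sides, their least levels and the exponents of the order *)

Section Sides.
Variables (m : nat) (sigma : {set pedge m.+3}).
Local Notation n := m.+3.
Local Notation proj := (proj m).
Local Notation lifted := (lifted sigma).
Local Notation step := (step sigma).
Local Notation floors := (floors m).

Definition nth_side (i : 'I_n) : pedge n := proj (i : nat, i.+1).
Definition side_index (g : pedge n) : 'I_n := if (g.2 : nat) == g.1.+1 then g.1 else g.2.
(** Level of the reference lift [(i, i.+1)]: zero, except for the last side, whose sorted pair
    starts at vertex 0. *)
Definition side_level (i : 'I_n) : nat := floors (i : nat, i.+1).

(* The least [k] such that [lift_at (nth_side j) k] dominates [(i, i + 1)]. *)
Definition min_level (i j : 'I_n) : nat :=
  if i <= j then ((i != 0 :> nat) && (j == m.+2 :> nat) : nat)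
  else if i == j.+1 :> nat then 1 else 2.

Lemma side_levelE i : side_level i = (i == m.+2 :> nat).
Proof.
rewrite /side_level /floors /= divn_small ?ltn_ord // add0n.
have := ltn_ord i; case: eqP => [->|ne] ilt; first by rewrite divnn.
by rewrite divn_small //; lia.
Qed.

Lemma nth_side1 i : (nth_side i).1 = (if i == m.+2 :> nat then 0 else i) :> nat.
Proof.
have ilt := ltn_ord i; rewrite /nth_side /proj /mkE /=; case: eqP => [->|ne].
  by rewrite modnn modn_small //= modnn.
by rewrite !modn_small ?leqnn /= ?modn_small //; lia.
Qed.

Lemma nth_side2 i : (nth_side i).2 = (if i == m.+2 :> nat then m.+2 else i.+1) :> nat.
Proof.
have ilt := ltn_ord i; rewrite /nth_side /proj /mkE /=; case: eqP => [->|ne].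
  by rewrite modnn modn_small //= modn_small.
by rewrite !modn_small ?leqnn /= ?modn_small //; lia.
Qed.

Lemma lifted_side i : lifted (i : nat, i.+1).
Proof. by rewrite /lifted /= edge_side; lia. Qed.

Lemma side_nth_side i : side (nth_side i).
Proof. by rewrite (side_proj (lifted_side i)) /= eqxx. Qed.

Lemma nth_sideK : cancel nth_side side_index.
Proof.
move=> i; apply: ord_inj; have ilt := ltn_ord i.
rewrite /side_index (fun_if (@nat_of_ord n)) nth_side1 nth_side2.
by case: (eqVneq (i : nat) m.+2) => ?; case: eqP; lia.
Qed.

Lemma side_indexK g : side g -> nth_side (side_index g) = g.
Proof.
case: g => a b; rewrite /side /adjacent /= => h.
have := ltn_ord a; have := ltn_ord b => bl al.
rewrite [LHS]surjective_pairing; congr (_, _); apply: ord_inj.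
  by rewrite /= nth_side1 /side_index /=; case: (eqVneq (b : nat) a.+1) => ?; case: eqP => ?; move: h; lia.
by rewrite /= nth_side2 /side_index /=; case: (eqVneq (b : nat) a.+1) => ?; case: eqP => ?; move: h; lia.
Qed.

Lemma nth_side_edgeset i : nth_side i \in edgeset sigma.
Proof. exact/side_edgeset/side_nth_side. Qed.

Lemma lift_at_nth_side i : lift_at (nth_side i) (side_level i) = (i : nat, i.+1).
Proof. exact: lift_at_proj (lifted_side i). Qed.

(** Two flips add [n] to both coordinates and so pass any [(i, i.+1)]; only levels 0 and 1 need
    computing. *)
Lemma le_lift_at (i j : 'I_n) k : le_edge (i : nat, i.+1) (lift_at (nth_side j) k) = (min_level i j <= k).
Proof.
have il := ltn_ord i; have jl := ltn_ord j.
case: k => [|[|k]].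
- rewrite /le_edge /lift_at /= nth_side1 nth_side2 /min_level.
  by case: (eqVneq (j : nat) m.+2) => ?; case: (leqP i j) => ?; case: (eqVneq (i : nat) 0) => ?;
    case: (eqVneq (i : nat) j.+1) => ?; rewrite /=; lia.
- rewrite /le_edge /lift_at /= nth_side1 nth_side2 /min_level.
  by case: (eqVneq (j : nat) m.+2) => ?; case: (leqP i j) => ?; case: (eqVneq (i : nat) 0) => ?;
    case: (eqVneq (i : nat) j.+1) => ?; rewrite /=; lia.
have -> : min_level i j <= k.+2.
  by rewrite /min_level; case: ifP => _; [case: (_ && _)|case: ifP].
by rewrite /le_edge /lift_at /=; lia.
Qed.

(** The exponent -1 appears because [(0, n - 1)], the last side at level 0, already dominates
    [(0, 1)] while the reference lift of that side has level 1. *)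
Lemma min_level_cexp i j : (cexp i j + Posz (side_level j))%R = Posz (min_level i j).
Proof.
have il := ltn_ord i; have jl := ltn_ord j.
rewrite side_levelE /cexp /min_level /=.
by case: (eqVneq (j : nat) m.+2) => ?; case: (leqP i j) => ?; case: (eqVneq (i : nat) 0) => ?;
    case: (eqVneq (i : nat) j.+1) => ?; rewrite /=; lia.
Qed.

Lemma side_level_le_min_level i j : side_level i <= min_level i j.
Proof.
have il := ltn_ord i; have jl := ltn_ord j; rewrite side_levelE /min_level.
by case: (eqVneq (j : nat) m.+2) => ?; case: (eqVneq (i : nat) m.+2) => ?; case: (leqP i j) => ?; case: (eqVneq (i : nat) 0) => ?;
    case: (eqVneq (i : nat) j.+1) => ?; rewrite /=; lia.
Qed.

Hypothesis triS : is_triangulation sigma.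

Definition is_side_path i j w s := [&& is_qpath sigma s, ohead s == Some (nth_side i),
  olast s == Some (nth_side j) & weight s == w].

Lemma side_path_lift i j w s : is_side_path i j w s ->
  exists2 t, path step (i : nat, i.+1) t & s = map proj ((i : nat, i.+1) :: t) /\
    last (i : nat, i.+1) t = lift_at (nth_side j) (side_level i + w).
Proof.
case/and4P; case: s => // x s /andP[_ ps] /eqP[xE]; rewrite xE in ps *.
rewrite olast_cons (inj_eq Some_inj) => /eqP lE /eqP ws.
have [t' [pt ts]] := lift_path triS (side_level i) ps.
rewrite lift_at_nth_side in pt; exists t' => //; rewrite map_cons ts; split => //.
have lY := path_step_lifted (lifted_side i) pt.
have fl := floors_last pt; rewrite map_cons ts ws in fl.
by rewrite -(lift_at_proj lY) fl -last_map ts lE.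
Qed.

Lemma side_path_level i j w s : is_side_path i j w s -> min_level i j <= w + side_level i.
Proof.
case/side_path_lift => t pt [_ lt].
by have := path_step_le pt; rewrite lt le_lift_at addnC.
Qed.

(** The implication provides a witness for every weight, as [xchoose] requires; below the bound the
    chosen list is arbitrary. *)
Lemma side_path_exists i j w :
  exists s, (min_level i j <= w + side_level i) ==> is_side_path i j w s.
Proof.
case: leqP => h; last by exists [::].
have lX := lifted_side i.
have lY := lifted_lift_at triS (w + side_level i) (nth_side_edgeset j).
have [|s ps ls] := reach triS lX lY; first by rewrite le_lift_at.
exists (map proj ((i : nat, i.+1) :: s)); apply/and4P; split => //.
- by rewrite /= nth_side_edgeset path_proj.
- rewrite olast_cons last_map ls proj_lift_at ?eqxx //.
  exact: (edgeset_lt triS (nth_side_edgeset j)).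
have := floors_last ps; rewrite ls floors_lift_at => E.
by apply/eqP/(@addIn (side_level i)); rewrite E addnC.
Qed.

Definition side_path i j w : seq (pedge n) := xchoose (side_path_exists i j w).

Lemma side_pathP i j w : min_level i j <= w + side_level i ->
  is_side_path i j w (side_path i j w).
Proof. by move=> h; have /implyP := xchooseP (side_path_exists i j w); apply. Qed.

Lemma side_path_eqJ (K : fieldType) i j w s t :
  is_side_path i j w s -> is_side_path i j w t -> @eqJ _ sigma K s t.
Proof.
by move=> /side_path_lift[s' ps [-> ls]] /side_path_lift[t' pt [-> lt]]; apply: thin => //; rewrite ls.
Qed.

End Sides.

(** * The isomorphism with the tiled order *)

Section Isomorphism.
Local Open Scope ring_scope.
Variables (m : nat) (sigma : {set pedge m.+3}) (K : fieldType).
Local Notation n := m.+3.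
Local Notation KQ := (KQ sigma K).
Local Notation pathel := (pathel sigma K).
Local Notation eF := (eF sigma K).
Local Notation inJ := (@inJ n sigma K).
Local Notation inFF := (@inFF n sigma K).
Local Notation sd := (@nth_side m).
Local Notation lev := (@side_level m).
Local Notation X := (tofrac ('X : {poly K})).
Local Notation weight_poly := (@weight_poly m sigma K).
Hypothesis triS : is_triangulation sigma.

(** The power of [X] conjugates by the diagonal matrix of the [X ^ side_level i], turning least
    weights into the exponents [cexp i j]. *)
Definition phi (u : KQ) : 'M[{fraction {poly K}}]_n :=
  \matrix_(i, j) (tofrac (weight_poly (sd i) (sd j) u) * X ^ ((lev i)%:Z - (lev j)%:Z)).

Lemma X_neq0 : X != 0.
Proof. by rewrite tofrac_eq0 polyX_eq0. Qed.

Lemma phiD u v : phi (u + v) = phi u + phi v.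
Proof. by apply/matrixP => i j; rewrite !mxE weight_polyD rmorphD mulrDl. Qed.

Lemma phiZ c u : phi (c *: u) = tofrac c%:P *: phi u.
Proof. by apply/matrixP => i j; rewrite !mxE weight_polyZ -mul_polyC rmorphM mulrA. Qed.

Lemma sum_sides (V : nmodType) (F : pedge n -> V) :
  \sum_(g | frozen g) F g = \sum_(i < n) F (sd i).
Proof.
rewrite (reindex_onto sd (@side_index m)) => [|g]; last exact: side_indexK.
by apply: eq_bigl => i; rewrite nth_sideK eqxx andbT; apply: (side_nth_side sigma).
Qed.

(** The entries of [u] vanish off the sides, so the sum over intermediate vertices reduces to the
    index set of the matrix product. *)
Lemma phiM u v : inFF u -> phi (kqmul u v) = phi u *m phi v.
Proof.
move=> hu; apply/matrixP => i j; rewrite !mxE weight_poly_mul.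
rewrite (bigID (@frozen n)) /= [X in _ + X]big1 ?addr0 => [|g ng]; last first.
  by rewrite (weight_poly_FF hu) ?mul0r // ng orbT.
rewrite sum_sides rmorph_sum mulr_suml; apply: eq_bigr => k _.
rewrite !mxE rmorphM mulrACA -expfzDr ?X_neq0 //.
by congr (_ * X ^ _); rewrite addrA subrK.
Qed.

Lemma phi_eF : phi eF = 1%:M.
Proof.
apply/matrixP => i j; rewrite !mxE weight_poly_eF (can_eq (@nth_sideK m)).
rewrite [frozen _](side_nth_side sigma) andbT; case: (i =P j) => [->|_].
  by rewrite subrr expr0z mulr1 rmorph1.
by rewrite rmorph0 mul0r.
Qed.

Lemma phi_min_cycle i c : frozen i -> min_cycle_at sigma i c ->
  phi (pathel c) = X *: phi (idem sigma K i).
Proof.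
move=> fi /(min_cycle_at_path triS)[s [-> ls ps ws]].
have ie := side_edgeset sigma fi.
apply/matrixP => k l; rewrite !mxE /idem !weight_poly_path /= ?ie //.
rewrite ls ws mulrA /pweight /=; case: ifP => _; last by rewrite rmorph0 mulr0.
by rewrite rmorph1 mulr1.
Qed.

(** A section of [weight_poly] on the polynomials without terms below the least weight. *)
Definition poly_path (i j : 'I_n) (q : {poly K}) : KQ :=
  \sum_(k < size q) q`_k *: pathel (side_path triS i j k).

Lemma poly_pathE N i j (q : {poly K}) : (size q <= N)%N ->
  poly_path i j q = \sum_(k < N) q`_k *: pathel (side_path triS i j k).
Proof.
move=> le; rewrite /poly_path -(big_mkord xpredT (fun k => q`_k *: pathel (side_path triS i j k))).
rewrite -[RHS](big_mkord xpredT (fun k => q`_k *: pathel (side_path triS i j k))).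
rewrite [RHS](big_cat_nat _ le) //= [X in _ + X]big_nat_cond [X in _ + X]big1 ?addr0 // => k.
by rewrite andbT => /andP[h _]; rewrite nth_default ?scale0r.
Qed.

Lemma poly_path_linear i j : linear (poly_path i j).
Proof.
move=> c p q; pose N := maxn (size p) (size q).
have hN : (size (c *: p + q)%R <= N)%N.
  apply: leq_trans (size_polyD _ _) _; rewrite geq_max leq_maxr andbT.
  by apply: leq_trans (size_scale_leq _ _) (leq_maxl _ _).
rewrite (poly_pathE _ _ hN) (poly_pathE _ _ (leq_maxl _ _ : _ <= N)%N).
rewrite (poly_pathE _ _ (leq_maxr _ _ : _ <= N)%N) scaler_sumr -big_split.
apply: eq_bigr => k _ /=; by rewrite coefD coefZ scalerDl scalerA.
Qed.

Lemma poly_path0 i j : poly_path i j 0 = 0.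
Proof. by rewrite /poly_path size_poly0 big_ord0. Qed.

Lemma poly_pathXn i j k : poly_path i j 'X^k = pathel (side_path triS i j k).
Proof.
rewrite /poly_path size_polyXn (bigD1 (Ordinal (ltnSn k))) //= coefXn eqxx scale1r.
rewrite big1 ?addr0 // => l; rewrite -val_eqE /= => /negbTE nl.
by rewrite coefXn nl scale0r.
Qed.

Lemma weight_poly_side_path e f i j w s : is_side_path sigma i j w s ->
  weight_poly e f (pathel s) = if (sd i == e) && (sd j == f) then 'X^w else 0.
Proof.
case/and4P; case: s => // x s qs /eqP[<-].
rewrite olast_cons (inj_eq Some_inj) => /eqP <- /eqP <-.
exact: weight_poly_path.
Qed.

Lemma eF_side_path i j w s : is_side_path sigma i j w s -> inFF (pathel s).
Proof.
have q1 k : is_qpath sigma [:: sd k] by rewrite /= nth_side_edgeset.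
case/and4P; case: s => // x s qs /eqP[xE].
rewrite olast_cons (inj_eq Some_inj) => /eqP lE _; subst x.
have E1 : kqmul eF (pathel (sd i :: s)) = pathel (sd i :: s).
  rewrite /Defs.eF sum_sides kqmul_suml (bigD1 i) //= big1 => [|k nk].
    by rewrite addr0 /idem mul_pathel // eqxx.
  rewrite /idem mul_pathel // -[last _ _]/(sd k).
  by rewrite (can_eq (@nth_sideK m)) (negbTE nk).
rewrite /Defs.inFF E1 /Defs.eF sum_sides kqmul_sumr (bigD1 j) //= big1 => [|k nk].
  by rewrite addr0 /idem mul_pathel // lE eqxx cats0.
by rewrite /idem mul_pathel // lE (can_eq (@nth_sideK m)) eq_sym (negbTE nk).
Qed.

Lemma eF_nonside x s : is_qpath sigma (x :: s) -> ~~ (frozen x && frozen (last x s)) ->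
  kqmul (kqmul eF (pathel (x :: s))) eF = 0.
Proof.
have q1 k : is_qpath sigma [:: sd k] by rewrite /= nth_side_edgeset.
move=> qs; rewrite negb_and => ns; rewrite /Defs.eF sum_sides.
rewrite (kqmul_suml _ _ (fun k => idem sigma K (sd k)) (pathel (x :: s))) kqmul_suml.
rewrite big1 // => k _; rewrite kqmul_sumr big1 // => l _.
rewrite /idem mul_pathel // -[last _ _]/(sd k); case: eqP => [xE|_]; last by rewrite kqmul0l.
rewrite -xE in qs ns *.
rewrite mul_pathel //; case: eqP => // lE.
by move: ns; rewrite lE /frozen !(side_nth_side sigma).
Qed.

Definition corner (u : KQ) : KQ := kqmul (kqmul eF u) eF.

Lemma cornerD u v : corner (u + v) = corner u + corner v.
Proof. exact: etrans (congr1 (fun x : KQ => kqmul x eF) (kqmulDr u v eF)) (kqmulDl _ _ _). Qed.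

Lemma cornerZ c u : corner (c *: u) = c *: corner u.
Proof. exact: etrans (congr1 (fun x : KQ => kqmul x eF) (kqmulZr c u eF)) (kqmulZl _ _ _). Qed.

Lemma corner0 : corner 0 = 0.
Proof. by apply: (addrI (corner 0)); rewrite -cornerD !addr0. Qed.

Lemma inFF0 : inFF 0.
Proof. exact: corner0. Qed.

Lemma inFFD u v : inFF u -> inFF v -> inFF (u + v).
Proof. by move=> hu hv; apply: etrans (cornerD u v) (congr2 +%R hu hv). Qed.

Lemma inFFZ c u : inFF u -> inFF (c *: u).
Proof. by move=> hu; apply: etrans (cornerZ c u) (congr1 _ hu). Qed.

Lemma inFF_sum I (r : seq I) (P : pred I) (F : I -> KQ) :
  (forall i, P i -> inFF (F i)) -> inFF (\sum_(i <- r | P i) F i).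
Proof. by move=> h; apply: big_ind => //; [apply: inFF0 | apply: inFFD]. Qed.

Definition corner_form (u : KQ) : KQ :=
  \sum_(i < n) \sum_(j < n) poly_path i j (weight_poly (sd i) (sd j) u).

Lemma corner_form_linear : linear corner_form.
Proof.
move=> c u v; rewrite /corner_form scaler_sumr -big_split; apply: eq_bigr => i _ /=.
rewrite scaler_sumr -big_split; apply: eq_bigr => j _ /=.
exact: etrans (congr1 (poly_path i j) (weight_poly_linear _ _ c u v)) (poly_path_linear _ _ _ _ _).
Qed.

Lemma corner_form_eq0 u : (forall i j, weight_poly (sd i) (sd j) u = 0) -> corner_form u = 0.
Proof.
move=> u0; rewrite /corner_form big1 // => i _; rewrite big1 // => j _.
by rewrite u0 poly_path0.
Qed.

(** By linearity [u] may be a single path: the corner kills it unless both ends are sides, and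
    otherwise it is congruent to the chosen path of the same ends and weight. *)
Lemma corner_normal_form (u : KQ) : inJ (corner u - corner_form u).
Proof.
have form0 : corner_form 0 = 0 by apply: corner_form_eq0 => i j; apply: weight_poly0.
elim/malg_lin_ind: u => [|u v hu hv|c u hu|p].
- by rewrite corner0 form0 subr0; apply: inJ0.
- have -> : corner (u + v) - corner_form (u + v) = (corner u - corner_form u) + (corner v - corner_form v).
    rewrite cornerD (malg_linearD corner_form_linear u v).
    move: (corner u) (corner v) (corner_form u) (corner_form v) => a b c d.
    by rewrite opprD addrACA.
  exact: inJD.
- have -> : corner (c *: u) - corner_form (c *: u) = c *: (corner u - corner_form u).
    rewrite cornerZ (malg_linearZ corner_form_linear c u).
    move: (corner u) (corner_form u) => a b.
    by rewrite scalerBr.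
  exact: inJZ.
have [x [s [pE xe ps]]] := qpathP p; rewrite -pathelE pE.
have qs : is_qpath sigma (x :: s) by rewrite /= xe.
case: (boolP (frozen x && frozen (last x s))) => [/andP[fx fl]|ns]; last first.
  rewrite /corner eF_nonside // corner_form_eq0 ?subr0; first exact: inJ0.
  move=> i j; rewrite weight_poly_path //; case: andP => // -[/eqP xi /eqP lj].
  by case/negP: ns; rewrite lj xi /frozen !(side_nth_side sigma).
pose i := side_index x; pose j := side_index (last x s); pose w := pweight x s.
have sp : is_side_path sigma i j w (x :: s).
  by rewrite /is_side_path qs olast_cons /= !side_indexK ?eqxx.
have -> : corner (pathel (x :: s)) = pathel (x :: s) by exact: eF_side_path sp.
rewrite /corner_form (bigD1 i) //= (bigD1 j) //= [X in _ + X + _]big1 => [|k nk]; last first.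
  by rewrite (weight_poly_side_path _ _ sp) !(can_eq (@nth_sideK m)) [j == k]eq_sym (negbTE nk) andbF poly_path0.
rewrite [X in _ - (_ + X)]big1 => [|k nk]; last first.
  rewrite big1 // => l _.
  by rewrite (weight_poly_side_path _ _ sp) !(can_eq (@nth_sideK m)) [i == k]eq_sym (negbTE nk) poly_path0.
rewrite !addr0 (weight_poly_side_path _ _ sp) !eqxx poly_pathXn.
exact: side_path_eqJ sp (side_pathP triS (side_path_level triS sp)).
Qed.

Lemma phi_eq0 u i j : phi u = 0 -> weight_poly (sd i) (sd j) u = 0.
Proof.
move=> /matrixP/(_ i j); rewrite !mxE => /eqP.
by rewrite mulf_eq0 tofrac_eq0 expfz_eq0 (negbTE X_neq0) andbF orbF => /eqP.
Qed.

Lemma phi_kernel u : inFF u -> (phi u = 0 <-> inJ u).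
Proof.
move=> hu; split=> [p0|hJ].
  have := corner_normal_form u; rewrite [corner u]hu corner_form_eq0 ?subr0 // => i j.
  exact: phi_eq0.
by apply/matrixP => i j; rewrite !mxE (weight_poly_inJ triS _ _ hJ) rmorph0 mul0r.
Qed.

Lemma weight_poly_dvd i j (u : KQ) : exists q,
  weight_poly (sd i) (sd j) u = q * 'X^(min_level i j - lev i).
Proof.
elim/malg_lin_ind: u => [|u v [p hp] [q hq]|c u [p hp]|p].
- by exists 0; rewrite weight_poly0 mul0r.
- by exists (p + q); rewrite weight_polyD hp hq mulrDl.
- by exists (c *: p); rewrite weight_polyZ hp scalerAl.
have [x [s [pE xe ps]]] := qpathP p; rewrite -pathelE pE.
have qs : is_qpath sigma (x :: s) by rewrite /= xe.
rewrite weight_poly_path //; case: andP => [[/eqP xi /eqP lj]|_]; last by exists 0; rewrite mul0r.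
have sp : is_side_path sigma i j (pweight x s) (x :: s).
  by rewrite /is_side_path qs olast_cons /= lj xi !eqxx.
have := side_path_level triS sp; rewrite addnC -leq_subLR => h.
by exists 'X^(pweight x s - (min_level i j - lev i)); rewrite -exprD subnK.
Qed.

(** Below the least weight the chosen lists are arbitrary, hence the condition on the low
    coefficients. *)
Lemma weight_poly_poly_path e f i j (q : {poly K}) :
  (forall k, (k + lev i < min_level i j)%N -> q`_k = 0) ->
  weight_poly e f (poly_path i j q) = if (sd i == e) && (sd j == f) then q else 0.
Proof.
move=> qlow; have term (k : nat) : weight_poly e f (q`_k *: pathel (side_path triS i j k)) =
    if (sd i == e) && (sd j == f) then q`_k *: 'X^k else 0.
  rewrite weight_polyZ; case: (ltnP (k + lev i) (min_level i j)) => [/qlow ->|h].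
    by rewrite !scale0r if_same.
  rewrite (weight_poly_side_path _ _ (side_pathP triS h)).
  by case: ifP; rewrite ?scaler0.
rewrite /poly_path weight_poly_sum; apply: etrans; first by apply: eq_bigr => k _; apply: term.
case: ifP => _; last by rewrite big1.
by rewrite -poly_def coefK.
Qed.

Lemma level_exponent i j :
  (min_level i j - lev i)%N%:Z + ((lev i)%:Z - (lev j)%:Z) = cexp i j.
Proof.
rewrite -subzn ?side_level_le_min_level // -min_level_cexp.
by rewrite addrA subrK addrK.
Qed.

Lemma X_exponent i j :
  X ^+ (min_level i j - lev i) * X ^ ((lev i)%:Z - (lev j)%:Z) = X ^ cexp i j.
Proof. by rewrite -level_exponent [RHS](expfzDr _ _ X_neq0). Qed.

Lemma phi_image M : inLambda M <-> exists2 u, inFF u & phi u = M.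
Proof.
split=> [hM|[u hu <-]]; last first.
  move=> i j; have [q hq] := weight_poly_dvd i j u; exists q.
  by rewrite mxE hq rmorphM rmorphXn -mulrA X_exponent.
have [f hf] := fin_all_exists (fun i => fin_all_exists (hM i)).
(* Multiplying by this power starts each polynomial at the least weight between its two sides, so
   only genuine paths occur. *)
pose q i j := f i j * 'X^(min_level i j - lev i).
have qlow i j k : (k + lev i < min_level i j)%N -> (q i j)`_k = 0.
  by move=> h; rewrite coefMXn; case: ltnP => //; lia.
exists (\sum_(i < n) \sum_(j < n) poly_path i j (q i j)).
  apply: inFF_sum => i _; apply: inFF_sum => j _; apply: inFF_sum => k _.
  case: (ltnP (k + lev i) (min_level i j)) => [/qlow ->|h].
    by rewrite scale0r; apply: inFF0.
  exact/inFFZ/eF_side_path/(side_pathP triS h).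
apply/matrixP => i j; rewrite mxE hf weight_poly_sum (bigD1 i) //= [X in tofrac (_ + X)]big1 => [|k nk]; last first.
  rewrite weight_poly_sum big1 // => l _; rewrite weight_poly_poly_path; last exact: qlow.
  by rewrite (can_eq (@nth_sideK m)) (negbTE nk).
rewrite addr0 weight_poly_sum (bigD1 j) //= [X in tofrac (_ + X)]big1 => [|k nk]; last first.
  rewrite weight_poly_poly_path; last exact: qlow.
  by rewrite [sd k == _](can_eq (@nth_sideK m)) (negbTE nk) andbF.
rewrite addr0 weight_poly_poly_path ?eqxx /=; last exact: qlow.
by rewrite rmorphM rmorphXn -mulrA X_exponent.
Qed.

End Isomorphism.

Local Open Scope ring_scope.

Theorem theorem2p25 (K : fieldType) (n : nat) (sigma : {set pedge n}) :
  (3 <= n)%N -> is_triangulation sigma ->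
  exists phi : KQ sigma K -> 'M[{fraction {poly K}}]_n,
    (* phi is K-linear *)
    (forall u v : KQ sigma K, phi (u + v) = phi u + phi v) /\
    (forall (c : K) (u : KQ sigma K), phi (c *: u) = tofrac (c%:P) *: phi u) /\
    (* phi is a unital ring morphism on e_F (K Q_sigma) e_F *)
    (forall u v, inFF u -> inFF v -> phi (kqmul u v) = phi u *m phi v) /\
    phi (eF sigma K) = 1%:M /\
    (* its kernel on e_F (K Q_sigma) e_F is e_F J e_F *)
    (forall u, inFF u -> (phi u = 0 <-> inJ u)) /\
    (* its image is Lambda *)
    (forall M, inLambda M <-> exists2 u, inFF u & phi u = M) /\
    (* it sends C (restricted to F) to x: phi(c) = x phi(e_i) for every
       minimal cycle c at a frozen vertex i *)
    (forall (i : pedge n) (c : seq (pedge n)), frozen i -> min_cycle_at sigma i c ->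
       phi (pathel sigma K c) = tofrac ('X : {poly K}) *: phi (idem sigma K i)).
Proof.
case: n sigma => [|[|[|m]]] // sigma _ triS.
exists (@phi m sigma K); split; first exact: phiD.
split; first exact: phiZ.
split; first by move=> u v hu _; apply: phiM.
split; first exact: phi_eF.
split; first exact: phi_kernel.
split; first exact: phi_image.
exact: phi_min_cycle.
Qed.
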